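(* Let $x,y$ be indeterminates, and take $Z_0(x,y)=1$. For all integers $n\ge 2$ and $0\le k\le n-1$, the boundary parameter coefficients in the singly-refined ASM generating function satisfy (as an identity of rational functions in $x,y$) $$\begin{aligned} Z_n(x,y)_k={}&Z_{n-1}(x,y)\,\delta_{k,0}+Z_{n-1}(x,y)\sum_{i=0}^{k-1}\Biggl(y^{i+1}\binom{k-1}{i}\binom{n-1}{i+1}\\ &+y^i\sum_{j_1=0}^{k-i-1}\sum_{j_2=0}^{n-i-2}\frac{Z_{n-i-1}(x,y)_{j_1}\,Z_{n-i-1}(x,y)_{j_2}}{Z_{n-i-1}(x,y)\,Z_{n-i-2}(x,y)}\Biggl(x\binom{k-j_1-2}{i-1}\binom{n-j_2-2}{i}\\ &\qquad\qquad-y\binom{k-j_1-1}{i}\binom{n-j_2-1}{i+1}\Biggr)\Biggr). \end{aligned}$$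
   Context: An alternating sign matrix (ASM) is a square matrix with entries in $\{0,1,-1\}$ such that along each row and each column the nonzero entries alternate in sign and sum to $1$. $\mathrm{ASM}(n)$ is the set of $n\times n$ ASMs. The first row of an ASM contains exactly one $1$, all other entries there being $0$. For $A\in\mathrm{ASM}(n)$ define: $\nu(A)=\sum_{1\le i<i'\le n,\;1\le j'\le j\le n}A_{ij}A_{i'j'}$ (a nonnegative integer); $\mu(A)=$ number of $-1$'s in $A$; $\rho_{\mathrm T}(A)=$ number of $0$'s to the left of the $1$ in the top row. For $n\ge1$: $Z_n(x,y;z)=\sum_{A\in\mathrm{ASM}(n)}x^{\nu(A)}y^{\mu(A)}z^{\rho_{\mathrm T}(A)}$; $Z_n(x,y)=Z_n(x,y;1)$; and $Z_n(x,y)_k$ denotes the coefficient of $z^k$ in $Z_n(x,y;z)$. Binomial coefficient convention: for $i=0$ the factor $\binom{k-j_1-2}{-1}$ appears; it equals $1$ if $k-j_1-2=-1$ and $0$ if $k-j_1-2\ge 0$. All other binomial coefficients appearing are standard, with nonnegative entries. *)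

(* Defs.v *)
From HB Require Import structures.
From mathcomp Require Import all_boot all_order all_algebra.

Set Implicit Arguments.
Unset Strict Implicit.
Unset Printing Implicit Defensive.

Import Order.TTheory GRing.Theory Num.Theory.
Local Open Scope ring_scope.

Definition alternating_line (s : seq int) : bool :=
  sorted (fun a b : int => a * b < 0) [seq a <- s | a != 0]
  && (\sum_(a <- s) a == 1).

Definition is_asm (n : nat) (A : 'M[int]_n) : bool :=
  [&& [forall i, forall j, A i j \in [:: 0; 1; -1]],
      [forall i, alternating_line [seq A i j | j <- enum 'I_n]]
    & [forall j, alternating_line [seq A i j | i <- enum 'I_n]]].

(* ['M[int]_n] is not a finType, so the finite set ASM(n) is carved out of the
   matrices whose entries lie in the finite subtype {0, 1, -1} of [int]. *)
Definition asm_entry : finType := seq_sub [:: 0; 1; -1 : int].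

Definition int_mx (n : nat) (A : 'M[asm_entry]_n) : 'M[int]_n :=
  map_mx (fun a : asm_entry => ssval a) A.

Definition ASM (n : nat) : {set 'M[asm_entry]_n} :=
  [set A | is_asm (int_mx A)].

Definition nu (n : nat) (A : 'M[int]_n) : int :=
  \sum_(i < n) \sum_(i' < n | (i < i')%N)
    \sum_(j < n) \sum_(j' < n | (j' <= j)%N) A i j * A i' j'.

Definition mu (n : nat) (A : 'M[int]_n) : nat :=
  #|[set p : 'I_n * 'I_n | A p.1 p.2 == -1]|.

(* Stated without [ord0], so that it makes sense (and is 0) for n = 0. *)
Definition rhoT (n : nat) (A : 'M[int]_n) : nat :=
  #|[set j : 'I_n | [exists i : 'I_n, exists j1 : 'I_n,
      [&& val i == 0, A i j1 == 1, (j < j1)%N & A i j == 0]]]|.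

(* Q(x, y), as the fraction field of Q[x][y]. *)
Definition ratfun : fieldType := {fraction {poly {poly rat}}}.
Definition x : ratfun := tofrac ('X%:P : {poly {poly rat}}).
Definition y : ratfun := tofrac ('X : {poly {poly rat}}).

(* Z_n(x, y; z), the polynomial variable being z. The exponent [nu] is an
   integer, hence the integer power of [x]; it is nonnegative on ASMs. *)
Definition Zpoly (n : nat) : {poly ratfun} :=
  \sum_(A in ASM n)
    (x ^ nu (int_mx A) * y ^+ mu (int_mx A)) *: 'X^(rhoT (int_mx A)).

Definition Z (n : nat) : ratfun := (Zpoly n).[1].

Definition Zcoef (n k : nat) : ratfun := (Zpoly n)`_k.

(* The value of Z_0 prescribed by convention. *)
Lemma Z0 : Z 0 = 1.
Proof.
have ASM0 (A : 'M[asm_entry]_0) : A \in ASM 0.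
  by rewrite inE; apply/and3P; split; apply/forallP => -[].
rewrite /Z /Zpoly.
rewrite /Z /Zpoly (big_pred1 (const_mx (SeqSub (mem_head 0 [:: 1; -1 : int])))).
  2: by move=> A; rewrite ASM0; apply/esym/eqP/matrixP => -[].
rewrite hornerZ hornerXn expr1n mulr1.
rewrite /nu big_ord0 expr0z mul1r /mu.
by rewrite (_ : [set _ | _] = set0) ?cards0 //; apply/setP => -[[]].
Qed.

(* Binomial coefficient (m choose k) with the convention that (m choose -1) is 1
   for m = -1 and 0 for m >= 0. *)
Definition binz (m k : int) : nat :=
  match m, k with
  | Posz m', Posz k' => 'C(m', k')
  | Negz 0, Negz 0 => 1
  | _, _ => 0
  end.

(* Main.v *)
Require Import Defs.
From HB Require Import structures.
From mathcomp Require Import all_boot all_order all_algebra all_field.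
From mathcomp Require Import ring zify.

Set Implicit Arguments.
Unset Strict Implicit.
Unset Printing Implicit Defensive.

Import Order.TTheory GRing.Theory Num.Theory.
Local Open Scope ring_scope.

(** Alternating sign matrices are the states of the six-vertex model with domain wall
    boundary.  Writing x = (1 + s)(1 + t) and y = s t, there are weights which are linear
    in a row and a column parameter, satisfy the Yang-Baxter equation, and restrict to the
    x, y-weights of ASMs when all parameters are 1.  The partition function is then the
    Izergin-Korepin determinant, and the Desnanot-Jacobi identity gives a quadratic
    relation.  Letting only the first row and the first column keep free parameters turns
    it into the following relation for the generating function Z_n(z, w) refined by the
    positions of the 1s in the first row and the first column:

      (1-z)(1-w) Z_n(z,w) Z_(n-2) = (1-z)(1-w) Z_(n-1) Z_(n-2) + y z w Z_(n-1)(z,w) Z_(n-1)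
                                   + z w (x(1-z)(1-w) - y) Z_(n-1)(z) Z_(n-1)(w).

    Dividing by (1-z)(1-w) and iterating expresses Z_n(z,w) / Z_(n-1) as a sum over i of
    powers of y z w / ((1-z)(1-w)) times products of singly refined generating functions;
    the formula is the coefficient of z^k w^(n-1) in Z_n(z,w) / (1-w), which equals the
    coefficient of z^k in Z_n(z,1). *)

(** * The six-vertex model *)

(** At equal parameters the determinant formula degenerates to 0/0, so it cannot be specialized
    there. The quadratic relation derived from it is polynomial in the parameters: it is proved for
    generic ones and survives specialization as long as the smallest partition function in it is
    nonzero. In that relation one row parameter [xi] and one column parameter [eta] stay free and
    all others become 1, so that each of the six partition functions has at most a free first row
    and a free first column. The refinement variables z and w are the ratios of [wa2] to [wb] along
    that row and column, which are Moebius functions of [xi] and [eta]. The parameters s and t are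
    the roots of T^2 + (1 + y - x) T + y and need not lie in Q(x, y). The final relation involves
    only x and y, so it can be proved over an extension field and brought back. *)

(* The state of an edge is a partial column sum [h] (vertical edges) or row sum [r]
   (horizontal edges) of the matrix.  [wa1], [wa2] are the weights of an entry 0 with
   h = r = 1, resp. h = r = 0, [wb] of an entry 0 with h <> r, [wcp] of an entry 1 and
   [wcm] of an entry -1. *)
Record weights (R U V : Type) := Weights {
  wa1 : U -> V -> R; wa2 : U -> V -> R; wb : U -> V -> R;
  wcp : U -> V -> R; wcm : U -> V -> R }.

Section Model.
Variables (R : comPzRingType) (U V : Type) (w : weights R U V).

(* Transfer operator of a row, acting on functions of the states of the vertical edges
   below it; the leftmost horizontal edge has state [r], the rightmost one state 1. *)
Fixpoint row_op (u : U) (vs : seq V) (r : bool) (f : seq bool -> R)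
    (hs : seq bool) {struct vs} : R :=
  match vs, hs with
  | [::], [::] => if r then f [::] else 0
  | v :: vs', h :: hs' =>
      if h == r then
        (if h then wa1 w u v else wa2 w u v)
          * row_op u vs' r (fun t => f (h :: t)) hs'
        + (if h then wcm w u v else wcp w u v)
          * row_op u vs' (~~ r) (fun t => f (~~ h :: t)) hs'
      else wb w u v * row_op u vs' r (fun t => f (h :: t)) hs'
  | _, _ => 0
  end.

(* The states of the top edges are [hs], those of the bottom edges are all 1. *)
Fixpoint pfun (us : seq U) (vs : seq V) (hs : seq bool) : R :=
  if us is u :: us' then row_op u vs false (pfun us' vs) hs else (all id hs)%:R.

Lemma eq_row_op u vs r f g hs : f =1 g -> row_op u vs r f hs = row_op u vs r g hs.
Proof.
elim: vs r f g hs => [|v vs IH] r f g [|h hs] //= fg; first by rewrite fg.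
have E r' h' := IH r' (fun t => f (h' :: t)) _ hs (fun t => fg (h' :: t)).
by rewrite !E.
Qed.

Lemma row_op_lin u vs r a f b g hs :
  row_op u vs r (fun t => a * f t + b * g t) hs
  = a * row_op u vs r f hs + b * row_op u vs r g hs.
Proof.
elim: vs r f g hs => [|v vs IH] r f g [|h hs] //=; rewrite ?mulr0 ?addr0 //.
  by case: r; rewrite ?mulr0 ?addr0.
have E r' h' := IH r' (fun t => f (h' :: t)) (fun t => g (h' :: t)) hs.
by rewrite !E; case: ifP => _; ring.
Qed.

Lemma row_opZ u vs r a f hs :
  row_op u vs r (fun t => a * f t) hs = a * row_op u vs r f hs.
Proof.
have := row_op_lin u vs r a f 0 f hs; rewrite mul0r addr0 => <-.
by apply: eq_row_op => t; rewrite mul0r addr0.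
Qed.

End Model.

(* At u = v = 1 these are (s - t) times the weights of alternating sign matrices for
   x = (1 + s)(1 + t) and y = s t. *)
Definition ik_weights (R : pzRingType) (s t : R) : weights R R R :=
  let A u v := s * u - t * v in
  Weights (fun u v => (1 + s) * (1 + t) * A u v) A
    (fun u v => s * (1 + t) * u - t * (1 + s) * v)
    (fun u v => (s - t) * u) (fun u v => s * t * (s - t) * v).

(** * Exchange of rows by the Yang-Baxter equation *)

Section YangBaxter.
Variables (K : fieldType) (s t : K).
Notation row := (row_op (ik_weights s t)).
Notation pf := (pfun (ik_weights s t)).

Definition row2 u u' vs r r' f := row u vs r (row u' vs r' f).

(** The coefficients are the entries of the R-matrix: a crossing of the two horizontal lines is
    moved from the left end to the right end. All four pairs of left states are treated together
    because they mix when a column is peeled off; at the right end both states are 1, where the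
    crossing acts trivially. *)
Lemma yang_baxter u u' vs f hs (d := (1 + s) * u' - (1 + t) * u) : d != 0 ->
  [/\ row2 u' u vs false false f hs = row2 u u' vs false false f hs,
      row2 u' u vs true true f hs = row2 u u' vs true true f hs,
      row2 u' u vs false true f hs =
        ((s - t) * u' * row2 u u' vs false true f hs
         + (1 + s) * (1 + t) * (u' - u) * row2 u u' vs true false f hs) / d
    & row2 u' u vs true false f hs =
        ((u' - u) * row2 u u' vs false true f hs
         + (s - t) * u * row2 u u' vs true false f hs) / d].
Proof.
move=> d0; rewrite /row2; elim: vs f hs => [|v vs IH] f [|h hs] /=; rewrite ?mulr0 ?addr0 ?mul0r //.
have [E00 E11 E01 E10] := IH (fun t => f (false :: t)) hs.
have [F00 F11 F01 F10] := IH (fun t => f (true :: t)) hs.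
(* What remains is the Yang-Baxter equation of a single column, a rational identity in the
   parameters. *)
case: h => /=; rewrite ?(row_op_lin, row_opZ);
  rewrite ?(E00, E11, E01, E10) ?(F00, F11, F01, F10) /d;
  by split; field; rewrite ?d0.
Qed.

Lemma pf_swap u u' us vs : (1 + s) * u' - (1 + t) * u != 0 ->
  pf (u' :: u :: us) vs =1 pf (u :: u' :: us) vs.
Proof. by move=> d0 hs; have [] := yang_baxter vs (pf us vs) hs d0. Qed.

End YangBaxter.

(** [pf_frozen] freezes only the first row; this brings any chosen row parameter there. *)
Lemma pf_move (K : fieldType) (s t : K) u us1 us2 vs :
    {in us1, forall u', (1 + s) * u' - (1 + t) * u != 0} ->
  pfun (ik_weights s t) (us1 ++ u :: us2) vs =1 pfun (ik_weights s t) (u :: us1 ++ us2) vs.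
Proof.
elim: us1 => [|u' us1 IH] den hs //=; rewrite -/(cat _ _).
rewrite (eq_row_op _ _ _ _ _ (IH _)); last first.
  by move=> a a_us; rewrite den // inE a_us orbT.
by rewrite -[LHS]/(pfun _ (u' :: u :: _) _ _) pf_swap // den // mem_head.
Qed.

Section General.
Variables (R : comPzRingType) (U V : Type) (w : weights R U V).

Lemma row_op_true_zeros u vs f :
  row_op w u vs true f (nseq (size vs) false)
  = \prod_(v <- vs) wb w u v * f (nseq (size vs) false).
Proof.
elim: vs f => [|v vs IH] f /=; first by rewrite big_nil mul1r.
by rewrite IH big_cons mulrA.
Qed.

(** Every row starts in state 0, which differs from the column state 1, so an entry 0 of weight [wb]
    is forced all the way down. *)
Lemma pf_column_true us v vs hs :
  pfun w us (v :: vs) (true :: hs) = \prod_(u <- us) wb w u v * pfun w us vs hs.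
Proof.
elim: us hs => [|u us IH] hs /=; first by rewrite big_nil mul1r.
by rewrite (eq_row_op _ _ _ _ _ IH) row_opZ big_cons mulrA.
Qed.

(* As [wa2 w u v = 0], the top left entry is 1, which freezes the first row and column. *)
Lemma pf_frozen u us v vs : wa2 w u v = 0 ->
  pfun w (u :: us) (v :: vs) (nseq (size vs).+1 false)
  = wcp w u v * \prod_(v' <- vs) wb w u v' * \prod_(u' <- us) wb w u' v
    * pfun w us vs (nseq (size vs) false).
Proof.
move=> uv0; rewrite /= uv0 mul0r add0r row_op_true_zeros pf_column_true; ring.
Qed.

End General.

Section Morphism.
Variables (R R' : comPzRingType) (phi : {rmorphism R -> R'}).
Variables (U V U' V' : Type) (fU : U -> U') (fV : V -> V').
Variables (w : weights R U V) (w' : weights R' U' V').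
Hypotheses (H1 : forall u v, phi (wa1 w u v) = wa1 w' (fU u) (fV v))
  (H2 : forall u v, phi (wa2 w u v) = wa2 w' (fU u) (fV v))
  (Hb : forall u v, phi (wb w u v) = wb w' (fU u) (fV v))
  (Hp : forall u v, phi (wcp w u v) = wcp w' (fU u) (fV v))
  (Hm : forall u v, phi (wcm w u v) = wcm w' (fU u) (fV v)).

Lemma rmorph_row_op u vs r f hs :
  phi (row_op w u vs r f hs) = row_op w' (fU u) (map fV vs) r (phi \o f) hs.
Proof.
elim: vs r f hs => [|v vs IH] r f [|h hs] //=; rewrite ?rmorph0 //.
  by case: r => //=; rewrite rmorph0.
by case: ifP => _; rewrite ?rmorphD !rmorphM !IH; case: (h); rewrite ?(H1, H2, Hb, Hp, Hm).
Qed.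

Lemma rmorph_pf us vs hs : phi (pfun w us vs hs) = pfun w' (map fU us) (map fV vs) hs.
Proof.
elim: us hs => [|u us IH] hs /=; first by rewrite rmorph_nat.
by rewrite rmorph_row_op; apply: eq_row_op => t /=; rewrite IH.
Qed.

End Morphism.

Lemma rmorph_ik (R R' : comPzRingType) (phi : {rmorphism R -> R'}) s t us vs hs :
  phi (pfun (ik_weights s t) us vs hs)
  = pfun (ik_weights (phi s) (phi t)) (map phi us) (map phi vs) hs.
Proof.
by apply: rmorph_pf => u v /=; rewrite ?(rmorphM, rmorphB, rmorphD, rmorph1).
Qed.

(** * Degree in the first column parameter *)

Section Degree.
Variables (K : fieldType) (s t : K).
Notation wX := (ik_weights s%:P t%:P).

Lemma size_row_op u vs r (f : seq bool -> {poly K}) hs d : (forall b, size (f b) <= d)%N ->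
  (size (row_op wX u%:P (map polyC vs) r f hs) <= d)%N.
Proof.
have /= [H1 H2 Hb Hp Hm] : [/\ forall v, wa1 wX u%:P v%:P = (wa1 (ik_weights s t) u v)%:P,
    forall v, wa2 wX u%:P v%:P = (wa2 (ik_weights s t) u v)%:P,
    forall v, wb wX u%:P v%:P = (wb (ik_weights s t) u v)%:P,
    forall v, wcp wX u%:P v%:P = (wcp (ik_weights s t) u v)%:P &
    forall v, wcm wX u%:P v%:P = (wcm (ik_weights s t) u v)%:P].
  by split=> v /=; rewrite ?(polyCM, polyCB, polyCD, polyC1).
elim: vs r f hs => [|v vs IH] r f [|h hs] fd; rewrite /= ?size_poly0 //.
  by case: r; rewrite ?size_poly0.
have sC (c : K) (p : {poly K}) : (size p <= d)%N -> (size (c%:P * p)%R <= d)%N.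
  by move=> pd; rewrite mul_polyC (leq_trans (size_scale_leq _ _)).
have sD (p q : {poly K}) : (size p <= d)%N -> (size q <= d)%N -> (size (p + q)%R <= d)%N.
  by move=> pd qd; rewrite (leq_trans (size_polyD _ _)) // geq_max pd.
have IH' r' h' := IH r' (fun t => f (h' :: t)) hs (fun b => fd (h' :: b)).
case: ifP => _; case: (h) => /=; rewrite ?H1 ?H2 ?Hb ?(Hp 0) ?Hm;
  do ?apply: sD; apply: sC; exact: IH'.
Qed.

(** In the first column the row state is 0, so only [wa2], [wb] and [wcp] occur. A column starting
    in state 0 contains one 1, whose weight [(s - t) * u] is free of the column parameter; this
    saves the degree that makes the interpolation in [ik_det] possible. *)
Lemma size_pfX us vs h hs :
  (size (pfun wX (map polyC us) ('X :: map polyC vs) (h :: hs)) <= size us + h)%N.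
Proof.
have lin (a b : K) (p : {poly K}) d :
    (size p <= d)%N -> (size ((a%:P - b%:P * 'X) * p)%R <= d.+1)%N.
  move=> pd; rewrite (leq_trans (size_polyMleq _ _)) // -subn1 leq_subLR.
  rewrite add1n -[d.+2]/(2 + d)%N leq_add // (leq_trans (size_polyD _ _)) // geq_max.
  rewrite size_polyN (leq_trans (size_polyC_leq1 _)) //=.
  by rewrite mul_polyC (leq_trans (size_scale_leq _ _)) // size_polyX.
elim: us h hs => [|u us IH] h hs.
  rewrite /=; case: h => /=; last by rewrite size_poly0.
  by case: (all _ _); rewrite ?size_poly1 ?size_poly0.
have row_size (h' : bool) r d : (size us + h' <= d)%N -> (size (row_op wX u%:P (map polyC vs) r
    (fun b => pfun wX (map polyC us) ('X :: map polyC vs) (h' :: b)) hs) <= d)%N.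
  by move=> le_d; apply: size_row_op => b; exact: leq_trans (IH _ _) le_d.
case: h => /=.
  rewrite -polyC1 -!polyCD -!polyCM addn1.
  by apply: lin; apply: row_size; rewrite addn1.
rewrite (leq_trans (size_polyD _ _)) // geq_max -!polyCM -polyCB -polyCM addn0; apply/andP; split.
  by apply: lin; apply: row_size; rewrite addn0.
by rewrite mul_polyC (leq_trans (size_scale_leq _ _)) // row_size // addn1.
Qed.

End Degree.

(** * The Izergin-Korepin determinant *)

Section Deletion.
Variable R : comNzRingType.

Definition del (i : nat) (us : seq R) := take i us ++ drop i.+1 us.

Lemma del_split i (us : seq R) : (i < size us)%N -> us = take i us ++ us`_i :: drop i.+1 us.
Proof. by move=> lt_i; rewrite -drop_nth // cat_take_drop. Qed.

Lemma size_del i (us : seq R) : (i < size us)%N -> size (del i us) = (size us).-1.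
Proof. by move=> lt_i; rewrite {2}(del_split lt_i) !size_cat /= addnS. Qed.

Lemma nth_del i (us : seq R) k : (i < size us)%N -> (del i us)`_k = us`_(bump i k).
Proof.
move=> lt_i; rewrite nth_cat size_take lt_i /bump.
case: ltnP => ki; first by rewrite nth_take.
by rewrite nth_drop addSn subnKC.
Qed.

Lemma mem_del i us : {subset del i us <= us}.
Proof.
by move=> u; rewrite mem_cat => /orP[/mem_take|/mem_drop].
Qed.

Lemma prod_del i (us : seq R) (F : R -> R) : (i < size us)%N ->
  \prod_(u <- us) F u = F us`_i * \prod_(u <- del i us) F u.
Proof.
move=> lt_i; rewrite {1}(del_split lt_i) !big_cat big_cons /=; ring.
Qed.

Lemma prod_neq_del n (i : 'I_n.+1) (us : seq R) (F : R -> R) : size us = n.+1 ->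
  \prod_(k < n.+1 | k != i) F us`_k = \prod_(u <- del i us) F u.
Proof.
move=> sz; rewrite big_mkcond (bigD1_ord i) //= eqxx mul1r (big_nth 0) size_del sz //= big_mkord.
by apply: eq_bigr => k _; rewrite nth_del ?sz // eq_sym neq_lift.
Qed.

Lemma del_subseq i (us : seq R) : subseq (del i us) us.
Proof.
by rewrite -{2}(cat_take_drop i us) cat_subseq // -add1n -drop_drop drop_subseq.
Qed.

Fixpoint vdm (us : seq R) : R :=
  if us is u :: us' then \prod_(u' <- us') (u' - u) * vdm us' else 1.

Lemma vdm_del i us : (i < size us)%N ->
  vdm us = (-1) ^+ i * \prod_(u <- del i us) (u - us`_i) * vdm (del i us).
Proof.
move=> lt_i; rewrite {1}(del_split lt_i) /del.
have sz : size (take i us) = i by rewrite size_take lt_i.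
rewrite -[X in (-1) ^+ X]sz {sz}; elim: (take i us) => [|a s1 IH] /=; first by rewrite expr0 mul1r.
rewrite IH !big_cat !big_cons big_cat /= exprS; ring.
Qed.

End Deletion.

Lemma vdm_neq0 (R : idomainType) (us : seq R) : uniq us -> vdm us != 0.
Proof.
elim: us => [|u us IH] /=; first by rewrite oner_neq0.
case/andP=> u_us /IH nz; rewrite mulf_neq0 // prodf_seq_neq0.
by apply/allP => a a_us /=; rewrite subr_eq0; apply: contraNneq u_us => <-.
Qed.

Section Izergin.
Variables (K : fieldType) (s t : K).
Hypotheses (s0 : s != 0) (t0 : t != 0).
Notation pf := (pfun (ik_weights s t)).

Definition ik_ab (R : pzRingType) (s t u v : R) :=
  (s * u - t * v) * (s * (1 + t) * u - t * (1 + s) * v).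
Notation ab := (ik_ab s t).

Definition ik_mx n (us vs : seq K) : 'M[K]_n := \matrix_(i, j) (ab us`_i vs`_j)^-1.

Lemma size_prod_le (I : Type) (r : seq I) (P : pred I) (F : I -> {poly K}) d :
  (forall i, P i -> size (F i) <= d.+1)%N ->
  (size (\prod_(i <- r | P i) F i)%R <= (count P r * d).+1)%N.
Proof.
move=> Fd; elim: r => [|i r IH]; first by rewrite big_nil size_poly1.
rewrite big_cons /=; case: ifPn => Pi; last by rewrite add0n.
rewrite (leq_trans (size_polyMleq _ _)) // mulnDl mul1n.
rewrite -subn1 leq_subLR add1n -addSn -addnS leq_add ?Fd //.
Qed.

Lemma prod_scale (I : Type) (r : seq I) (c : K) (F : I -> K) :
  \prod_(i <- r) (c * F i) = c ^+ size r * \prod_(i <- r) F i.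
Proof.
elim: r => [|i r IH]; first by rewrite !big_nil expr0 mul1r.
rewrite !big_cons IH /= exprS; ring.
Qed.

(** [s * u / t] is the column parameter at which [wa2] vanishes in the row of [u]. This lemma and
    [prod_ab_col] rewrite the products of [ik_ab] that arise at this interpolation point. *)
Lemma prod_ab_row u vs : \prod_(w <- vs) ab u w
  = (- t) ^+ size vs * \prod_(w <- vs) (w - s * u / t)
    * \prod_(w <- vs) wb (ik_weights s t) u w.
Proof.
rewrite -prod_scale -big_split /=; apply: eq_bigr => w _.
by rewrite /ik_ab; congr (_ * _); field.
Qed.

Lemma prod_ab_col us u : \prod_(u' <- us) ab u' (s * u / t)
  = s ^+ size us * \prod_(u' <- us) (u' - u)
    * \prod_(u' <- us) wb (ik_weights s t) u' (s * u / t).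
Proof.
rewrite -prod_scale -big_split /=; apply: eq_bigr => w _.
by rewrite /ik_ab; congr (_ * _); field.
Qed.

(** Each freezing step contributes [s - t] from [wcp]; the power of [- (s * t)^-1] cancels the
    powers of [- t] and [s] in [prod_ab_row] and [prod_ab_col]. *)
Definition ik_const n := \prod_(i < n) ((s - t) * (- (s * t)^-1) ^+ i).

(* In size n + 1, both sides are polynomials of degree at most 2n in the first column
   parameter, up to a common factor.  They agree at the n + 1 points s u / t, where the
   model freezes, and at the n other column parameters, where two columns of the matrix
   coincide. *)
Lemma ik_det n us vs : size us = n -> size vs = n -> uniq us -> uniq vs ->
    {in us & vs, forall u v, ab u v != 0} ->
    {in us &, forall u u', (1 + s) * u' - (1 + t) * u != 0} ->
  pf us vs (nseq n false) * vdm us * vdm vs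
  = ik_const n * \prod_(u <- us) u * (\prod_(u <- us) \prod_(v <- vs) ab u v)
    * \det (ik_mx n us vs).
Proof.
elim: n us vs => [|n IH] us vs.
  move=> /size0nil -> /size0nil -> _ _ _ _.
  by rewrite det_mx00 /ik_const big_ord0 !big_nil /= !mulr1.
case: vs => // v vs sz_us [sz_vs] us_uniq /= /andP[v_vs vs_uniq] ab0 den.
have st u w : w \in vs -> u \in us -> s * u / t != w.
  move=> w_vs u_us; apply: contraNneq (ab0 u w u_us _) => [<-|]; last by rewrite inE w_vs orbT.
  by rewrite /ab mulrCA divff // mulr1 subrr mul0r.
pose M := ik_mx n.+1 us (v :: vs).
pose abX u : {poly K} := ik_ab s%:P t%:P u%:P 'X.
have abXE u w : (abX u).[w] = ab u w by rewrite /abX /ab !hornerE.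
(* The determinant expanded along its first column, with the denominators of that column cleared:
   each summand omits the factor of its own row. *)
pose E := \sum_(i < n.+1) (cofactor M i 0)%:P * \prod_(k < n.+1 | k != i) abX us`_k.
pose P := pfun (ik_weights s%:P t%:P) (map polyC us) ('X :: map polyC vs) (nseq n.+1 false).
have PE w : P.[w] = pf us (w :: vs) (nseq n.+1 false).
  rewrite /P -/(horner_eval w _) rmorph_ik /= /horner_eval !hornerE.
  by congr (pfun _ _ (_ :: _) _); rewrite -map_comp map_id_in // => u _ /=;
    rewrite /horner_eval hornerC.
pose Q1 := P * \prod_(w <- vs) (w%:P - 'X) * (vdm us * vdm vs)%:P.
pose Q2 := (ik_const n.+1 * \prod_(u <- us) u * \prod_(u <- us) \prod_(w <- vs) ab u w)%:P * E.
have rs_uniq : uniq ([seq s * u / t | u <- us] ++ vs).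
  rewrite cat_uniq vs_uniq andbT map_inj_uniq ?us_uniq /=; last first.
    by move=> a b /(mulIf (invr_neq0 t0)) /(mulfI s0).
  by apply/hasPn => w w_vs; apply/mapP => -[u u_us]; apply/eqP; rewrite eq_sym st.
have sz_us_i (i : 'I_n.+1) : (i < size us)%N by rewrite sz_us.
have us_i (i : 'I_n.+1) : us`_i \in us by rewrite mem_nth.
have minorE (i : 'I_n.+1) : cofactor M i 0 = (-1) ^+ i * \det (ik_mx n (del i us) vs).
  rewrite /cofactor addn0; congr (_ * \det _); apply/matrixP => k l.
  by rewrite !mxE nth_del.
have EE w : {in us, forall u, ab u w != 0} ->
    E.[w] = \prod_(u <- us) ab u w * \sum_(i < n.+1) (ab us`_i w)^-1 * cofactor M i 0.
  move=> abw; rewrite horner_sum mulr_sumr; apply: eq_bigr => i _.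
  rewrite hornerM hornerC horner_prod (prod_del (i := i)) //.
  rewrite (eq_bigr (fun k : 'I_n.+1 => ab us`_k w)); last by move=> k _; rewrite abXE.
  by rewrite (@prod_neq_del _ _ _ _ (fun u => ab u w)) //; field; rewrite abw.
have Q1Q2 : Q1 = Q2.
  apply/eqP; rewrite -subr_eq0; apply/eqP; apply: (roots_geq_poly_eq0 _ rs_uniq).
    rewrite all_cat; apply/andP; split; apply/allP => w; last first.
      move=> w_vs; rewrite /root hornerD hornerN /Q1 /Q2 !hornerM horner_prod.
      rewrite (prod_del (i := index w vs)) ?index_mem // nth_index // !hornerE subrr.
      rewrite /= !(mul0r, mulr0) add0r oppr_eq0; apply/eqP.
      rewrite EE; last by move=> u u_us; rewrite ab0 // inE w_vs orbT.
      have lt_w : (index w vs < n)%N by rewrite -sz_vs index_mem.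
      (* Expansion by alien cofactors: the cofactors of column 0 paired with another column sum to
         0. *)
      have := mul_adj_mx M => /matrixP /(_ 0 (lift 0 (Ordinal lt_w))).
      rewrite !mxE (negbTE (neq_lift _ _)) mulr0n => M0.
      rewrite [X in _ * (_ * X)](_ : _ = 0) ?mulr0 // -[RHS]M0; apply: eq_bigr => i _.
      by rewrite !mxE /= nth_index // mulrC.
    case/mapP=> u u_us ->; rewrite /root hornerD hornerN subr_eq0; apply/eqP.
    have lt_u : (index u us < n.+1)%N by rewrite -sz_us index_mem.
    pose i := Ordinal lt_u; have ui : us`_i = u by rewrite nth_index.
    (* This zero of [wa2] kills every summand of [E] but the [i]-th, and it freezes the model once
       the row of [u] is moved to the top. *)
    have Au : s * u - t * (s * u / t) = 0 by field.
    rewrite /Q1 /Q2 !hornerM !hornerC PE horner_sum (bigD1 i) //=.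
    rewrite [X in _ * (_ + X)]big1 ?addr0; last first.
      move=> k ki; rewrite hornerM horner_prod (bigD1 i) ?(eq_sym i) //= abXE ui.
      by rewrite /ab Au !mul0r mulr0.
    rewrite hornerM hornerC !horner_prod minorE.
    rewrite (eq_bigr (fun k : 'I_n.+1 => ab us`_k (s * u / t))); last by move=> k _; rewrite abXE.
    rewrite (@prod_neq_del _ _ _ _ (fun u' => ab u' (s * u / t))) //.
    have lt_i : (i < size us)%N by [].
    have -> : pf us (s * u / t :: vs) (nseq n.+1 false)
        = pf (u :: del i us) (s * u / t :: vs) (nseq n.+1 false).
      rewrite {1}(del_split lt_i) ui pf_move // => u' /mem_take u'_us; exact: den.
    have -> : nseq n.+1 false = nseq (size vs).+1 false by rewrite sz_vs.
    rewrite pf_frozen //= sz_vs.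
    have := IH (del i us) vs.
    rewrite size_del // sz_us => /(_ erefl sz_vs) IHi.
    have {}IHi := IHi (subseq_uniq (del_subseq i us) us_uniq) vs_uniq.
    have {}IHi : pf (del i us) vs (nseq n false) * vdm (del i us) * vdm vs =
        ik_const n * \prod_(u <- del i us) u * (\prod_(u <- del i us) \prod_(v <- vs) ab u v)
          * \det (ik_mx n (del i us) vs).
      apply: IHi; first by move=> a b /mem_del a_us b_vs; rewrite ab0 // inE b_vs orbT.
      by move=> a b /mem_del a_us /mem_del b_us; exact: den.
    rewrite (vdm_del lt_i) ui (prod_del _ lt_i).
    rewrite (prod_del (fun u => \prod_(w <- vs) ab u w) lt_i) ui.
    have -> : ik_const n.+1 = ik_const n * ((s - t) * (- (s * t)^-1) ^+ n).
      by rewrite /ik_const big_ord_recr.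
    rewrite prod_ab_row prod_ab_col size_del // sz_us sz_vs /=.
    rewrite [RHS](_ : _ = (ik_const n * \prod_(u <- del i us) u
          * (\prod_(u <- del i us) \prod_(v <- vs) ab u v) * \det (ik_mx n (del i us) vs))
        * ((s - t) * u * \prod_(v' <- vs) wb (ik_weights s t) u v'
           * \prod_(u' <- del i us) wb (ik_weights s t) u' (s * u / t) * (-1) ^+ i
           * \prod_(u' <- del i us) (u' - u) * \prod_(w <- vs) (w - s * u / t))
        * ((- (s * t)^-1) ^+ n * (- t) ^+ n * s ^+ n)); last by ring.
    rewrite -IHi -!exprMn (_ : _ * s = 1) ?expr1n; last by field; rewrite ?s0 ?t0.
    rewrite /=; have -> : \prod_(w <- vs) (w%:P - 'X).[s * u / t] = \prod_(w <- vs) (w - s * u / t).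
      by apply: eq_bigr => w1 _; rewrite !hornerE.
    ring.
  rewrite size_cat size_map sz_us sz_vs (leq_trans (size_polyD _ _)) // geq_max size_polyN.
  apply/andP; split.
    rewrite /Q1 mulrC mul_polyC (leq_trans (size_scale_leq _ _)) //.
    rewrite (leq_trans (size_polyMleq _ _)) // -subn1 leq_subLR.
    have := size_pfX s t us vs false (nseq n false); rewrite sz_us addn0 => szP.
    have : (size (\prod_(w <- vs) (w%:P - 'X) : {poly K})%R <= (count predT vs * 1).+1)%N.
      apply: size_prod_le => w _; rewrite -opprB size_polyN size_XsubC //.
    rewrite count_predT sz_vs muln1 => szW.
    by rewrite (leq_trans (leq_add szP szW)) // addnS add1n.
  rewrite /Q2 mul_polyC (leq_trans (size_scale_leq _ _)) //.
  apply: (leq_trans (size_sum _ _ _)); apply/bigmax_leqP => i _.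
  rewrite mul_polyC (leq_trans (size_scale_leq _ _)) //.
  apply: leq_trans (size_prod_le (d := 2) _ _) _ => [k _|].
    rewrite /abX /ik_ab (leq_trans (size_polyMleq _ _)) // -subn1 leq_subLR.
    have lin (a b : K) : (size (a%:P - b%:P * 'X)%R <= 2)%N.
      rewrite (leq_trans (size_polyD _ _)) // geq_max size_polyN (leq_trans (size_polyC_leq1 _)) //.
      by rewrite mul_polyC (leq_trans (size_scale_leq _ _)) // size_polyX.
    by rewrite -polyC1 -!polyCD -!polyCM (leq_trans (leq_add (lin _ _) (lin _ _))).
  rewrite -size_filter.
  have -> : size [seq k <- index_enum 'I_n.+1 | k != i] = n.
    by rewrite -sum1_size big_filter sum1_card cardC1 card_ord.
  by rewrite muln2 -addnn addSn.
have := congr1 (horner^~ v) Q1Q2; rewrite /Q1 /Q2 !hornerM !hornerC PE horner_prod EE; last first.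
  by move=> u u_us; rewrite ab0 // mem_head.
have -> : \sum_(i < n.+1) (ab us`_i v)^-1 * cofactor M i 0 = \det M.
  by rewrite (expand_det_col M 0); apply: eq_bigr => i _; rewrite !mxE.
have -> : \prod_(w <- vs) (w%:P - 'X).[v] = \prod_(w <- vs) (w - v).
  by apply: eq_bigr => w _; rewrite !hornerE.
have -> : \prod_(u <- us) \prod_(w <- v :: vs) ab u w
    = \prod_(u <- us) ab u v * \prod_(u <- us) \prod_(w <- vs) ab u w.
  by rewrite -big_split; apply: eq_bigr => u _; rewrite big_cons.
move=> eqQ; rewrite [RHS](_ : _ = ik_const n.+1 * \prod_(u <- us) u
    * \prod_(u <- us) \prod_(w <- vs) ab u w * (\prod_(u <- us) ab u v * \det M)); last by ring.
by rewrite -eqQ -[false :: _]/(nseq n.+1 false); ring.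
Qed.

End Izergin.

(** * The Desnanot-Jacobi identity and the quadratic relation *)

Lemma det_schur (F : fieldType) m n (P : 'M[F]_m) (Q : 'M_(m, n)) (R : 'M_(n, m))
    (A : 'M_n) : A \in unitmx ->
  \det (block_mx P Q R A) = \det A * \det (P - Q *m invmx A *m R).
Proof.
move=> Au.
have -> : block_mx P Q R A
    = block_mx 1%:M (Q *m invmx A) 0 1%:M *m block_mx (P - Q *m invmx A *m R) 0 R A.
  rewrite mulmx_block !mul1mx !mul0mx !add0r mulmxKV //.
  by rewrite subrK.
by rewrite det_mulmx det_ublock det_lblock !det1 !mul1r mulrC.
Qed.

Lemma det_mx2 (R : comNzRingType) (A : 'M[R]_2) :
  \det A = A 0 0 * A 1 1 - A 0 1 * A 1 0.
Proof.
rewrite (expand_det_col A 0) !big_ord_recl big_ord0 addr0 /cofactor !det_mx11 !mxE /=.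
have e0 : lift (0 : 'I_2) 0 = 1 by apply: val_inj.
have e1 : lift (1 : 'I_2) 0 = 0 by apply: val_inj.
by rewrite !e0 !e1 /=; ring.
Qed.

(** By Schur complements both sides are the square of [\det A] times the 2 x 2 determinant of
    [P - Q *m invmx A *m R]. *)
Lemma desnanot_jacobi (F : fieldType) n (P : 'M[F]_2) (Q : 'M_(2, n)) (R : 'M_(n, 2))
    (A : 'M_n) (N := fun i j => block_mx (P i j)%:M (row i Q) (col j R) A : 'M_(1 + n)) :
  A \in unitmx ->
  \det (block_mx P Q R A) * \det A
  = \det (N 0 0) * \det (N 1 1) - \det (N 0 1) * \det (N 1 0).
Proof.
move=> Au; rewrite /N !det_schur // !det_mx11 det_mx2.
have E i j : ((P i j)%:M - row i Q *m invmx A *m col j R : 'M_1) 0 0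
    = (P - Q *m invmx A *m R) i j.
  rewrite -!row_mul !mxE eqxx mulr1n; congr (_ - _); apply: eq_bigr => k _.
  by rewrite !mxE.
rewrite !E; ring.
Qed.

Section Jacobi.
Local Arguments pfun : simpl never.

Variables (K : fieldType) (s t : K).
Hypotheses (s0 : s != 0) (t0 : t != 0).
Notation pf us vs := (pfun (ik_weights s t) us vs (nseq (size us) false)).
Notation ab := (ik_ab s t).
Variables (u1 u2 v1 v2 : K) (us vs : seq K).
Hypothesis sz : size us = size vs.

Lemma ik_mx_jacobi n : size us = n -> size vs = n -> \det (ik_mx s t n us vs) != 0 ->
  \det (ik_mx s t n.+2 (u1 :: u2 :: us) (v1 :: v2 :: vs)) * \det (ik_mx s t n us vs)
  = \det (ik_mx s t n.+1 (u1 :: us) (v1 :: vs)) * \det (ik_mx s t n.+1 (u2 :: us) (v2 :: vs))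
  - \det (ik_mx s t n.+1 (u1 :: us) (v2 :: vs)) * \det (ik_mx s t n.+1 (u2 :: us) (v1 :: vs)).
Proof.
move=> us_n vs_n A0.
pose M := ik_mx s t n.+2 (u1 :: u2 :: us) (v1 :: v2 :: vs) : 'M_(2 + n).
have := @desnanot_jacobi _ n (ulsubmx M) (ursubmx M) (dlsubmx M) (drsubmx M).
have -> : drsubmx M = ik_mx s t n us vs by apply/matrixP => i j; rewrite !mxE.
rewrite unitmxE unitfE => /(_ A0).
set Mb := block_mx (ulsubmx M) _ _ _.
have -> : Mb = M.
  rewrite -[RHS](@submxK _ 2 n 2 n); congr block_mx.
  by apply/matrixP => i j; rewrite !mxE.
have bordE (i j : 'I_2) : block_mx (ulsubmx M i j)%:M (row i (ursubmx M))
    (col j (dlsubmx M)) (ik_mx s t n us vs)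
    = ik_mx s t n.+1 (nth 0 [:: u1; u2] i :: us) (nth 0 [:: v1; v2] j :: vs) :> 'M_(1 + n).
  apply/matrixP => k l; rewrite -[k]splitK -[l]splitK.
  case: (split k) => k'; case: (split l) => l';
    rewrite ?(block_mxEul, block_mxEur, block_mxEdl, block_mxEdr) !mxE /=.
  - by rewrite !ord1 eqxx mulr1n; case: i => -[|[|i]] // ?; case: j => -[|[|j]].
  - by rewrite !ord1; case: i => -[|[|i]].
  - by rewrite !ord1; case: j => -[|[|j]].
  - by [].
by rewrite !bordE.
Qed.

(** All six determinants are replaced through [ik_det]. The factor [- (s * t)] is what the constants
    [ik_const] leave over, [(u2 - u1) * (v2 - v1)] comes from the Vandermonde products, and the [ab]
    factors are those missing from the smaller double products. *)
Lemma pf_jacobi (US := u1 :: u2 :: us) (VS := v1 :: v2 :: vs) :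
    uniq US -> uniq VS -> {in US & VS, forall u v, ab u v != 0} ->
    {in US &, forall u u', (1 + s) * u' - (1 + t) * u != 0} ->
    pf us vs != 0 ->
  - (s * t) * (u2 - u1) * (v2 - v1) * pf US VS * pf us vs
  = ab u1 v2 * ab u2 v1 * pf (u1 :: us) (v1 :: vs) * pf (u2 :: us) (v2 :: vs)
    - ab u1 v1 * ab u2 v2 * pf (u1 :: us) (v2 :: vs) * pf (u2 :: us) (v1 :: vs).
Proof.
move=> US_uniq VS_uniq ab0 den pf0.
have ik n us' vs' : size us' = n -> size vs' = n -> subseq us' US -> subseq vs' VS ->
    pfun (ik_weights s t) us' vs' (nseq n false) * vdm us' * vdm vs'
    = ik_const s t n * \prod_(u <- us') u * (\prod_(u <- us') \prod_(v <- vs') ab u v)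
      * \det (ik_mx s t n us' vs').
  move=> us'n vs'n sub_us sub_vs; apply: (ik_det s0 t0 us'n vs'n).
  - exact: subseq_uniq sub_us US_uniq.
  - exact: subseq_uniq sub_vs VS_uniq.
  - by move=> u v /(mem_subseq sub_us) ? /(mem_subseq sub_vs) ?; exact: ab0.
  - by move=> u v /(mem_subseq sub_us) ? /(mem_subseq sub_us) ?; exact: den.
have sub0 (a b : K) l : subseq l [:: a, b & l].
  exact: (subseq_trans (subseq_cons l b) (subseq_cons (b :: l) a)).
have sub1 (a b : K) l : subseq (a :: l) [:: a, b & l] by rewrite /= eqxx; exact: subseq_cons.
have sub2 (a b : K) l : subseq (b :: l) [:: a, b & l] by exact: subseq_cons.
pose n := size us.
have szv : size vs = n by rewrite -sz.
have vdm0 (l : seq K) : uniq l -> vdm l != 0 := @vdm_neq0 _ l.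
(* For equal arguments [den] says that [(s - t) * u] is nonzero; it gives [s != t] here and nonzero
   row parameters below. *)
have st0 : s - t != 0.
  have := den u1 u1 (mem_head _ _) (mem_head _ _); apply: contraNneq => st.
  have -> : (1 + s) * u1 - (1 + t) * u1 = (s - t) * u1 by ring.
  by rewrite st mul0r.
have D0 : \det (ik_mx s t n us vs) != 0.
  apply: contraNneq pf0 => D0.
  have := ik n us vs erefl szv (sub0 _ _ _) (sub0 _ _ _).
  rewrite D0 mulr0 => /eqP; rewrite !mulf_eq0 => /orP[/orP[|]|] //.
    by rewrite (negbTE (vdm0 _ (subseq_uniq (sub0 _ _ _) US_uniq))).
  by rewrite (negbTE (vdm0 _ (subseq_uniq (sub0 _ _ _) VS_uniq))).
have DJ := ik_mx_jacobi erefl szv D0.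
have prod2 (v : K) (l l' : seq K) : \prod_(u <- l) \prod_(w <- v :: l') ab u w
    = \prod_(u <- l) ab u v * \prod_(u <- l) \prod_(w <- l') ab u w.
  by rewrite -big_split; apply: eq_bigr => u _; rewrite big_cons.
have US0 u : u \in US -> u != 0.
  move=> u_US; have := den u u u_US u_US; apply: contraNneq => ->.
  by rewrite !mulr0 subr0.
have abn0 (l l' : seq K) : subseq l US -> subseq l' VS ->
    \prod_(u <- l) \prod_(w <- l') ab u w != 0.
  move=> /mem_subseq lU /mem_subseq lV; rewrite prodf_seq_neq0; apply/allP => u u_l /=.
  rewrite prodf_seq_neq0; apply/allP => w w_l /=; exact: ab0 (lU _ u_l) (lV _ w_l).
have c0 m : ik_const s t m != 0.
  by apply/prodf_neq0 => i _; rewrite mulf_neq0 // expf_neq0 // oppr_eq0 invr_eq0 mulf_neq0.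
have P0 (l : seq K) : subseq l US -> \prod_(u <- l) u != 0.
  by move=> /mem_subseq lU; rewrite prodf_seq_neq0; apply/allP => u /lU /US0.
have solve (x c D : K) : c != 0 -> x = c * D -> D = x / c.
  by move=> c_n0 ->; field.
have detE m us' vs' : size us' = m -> size vs' = m -> subseq us' US -> subseq vs' VS ->
    \det (ik_mx s t m us' vs')
    = pfun (ik_weights s t) us' vs' (nseq m false) * vdm us' * vdm vs' /
      (ik_const s t m * \prod_(u <- us') u * \prod_(u <- us') \prod_(v <- vs') ab u v).
  move=> us'n vs'n sub_us sub_vs; apply: solve (ik _ _ _ us'n vs'n sub_us sub_vs).
  by rewrite !mulf_neq0 ?abn0 ?P0.
have sub3 (a b c : K) l : subseq l [:: a, b & l] := sub0 a b l.
move: DJ (vdm0 _ US_uniq) (vdm0 _ VS_uniq) (abn0 _ _ (subseq_refl US) (subseq_refl VS))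
  (P0 _ (subseq_refl US)) (c0 n) (c0 n.+1).
rewrite !detE ?sub0 ?sub1 ?sub2 ?subseq_refl //= ?szv //.
rewrite /US /VS !big_cons !prod2 -/n.
have -> : ik_const s t n.+2 = ik_const s t n.+1 * ((s - t) * (- (s * t)^-1) ^+ n.+1).
  by rewrite /ik_const big_ord_recr.
have -> : ik_const s t n.+1 = ik_const s t n * ((s - t) * (- (s * t)^-1) ^+ n).
  by rewrite /ik_const big_ord_recr.
rewrite exprS; move: (pfun _ (u1 :: u2 :: us) _ _) (pfun _ us _ _).
move: (pfun _ (u1 :: us) (v1 :: vs) _) (pfun _ (u2 :: us) (v1 :: vs) _).
move: (pfun _ (u1 :: us) (v2 :: vs) _) (pfun _ (u2 :: us) (v2 :: vs) _).
move: (\prod_(u <- us) \prod_(v <- vs) ab u v) (\prod_(u <- us) ab u v1) (\prod_(u <- us) ab u v2).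
move: (\prod_(v <- vs) ab u1 v) (\prod_(v <- vs) ab u2 v).
move: (ab u1 v1) (ab u1 v2) (ab u2 v1) (ab u2 v2) => a11 a12 a21 a22.
move: (\prod_(u <- us) u) (ik_const s t n) ((- (s * t)^-1) ^+ n).
move: (vdm us) (vdm vs).
move: (\prod_(u' <- us) (u' - u1)) (\prod_(u' <- us) (u' - u2)).
move: (\prod_(u' <- vs) (u' - v1)) (\prod_(u' <- vs) (u' - v2)).
move=> e1 e2 d1 d2 d e Pu c r r1 r2 W c1 c2 p12 p22 p11 p21 p p0.
rewrite !mulf_eq0 !negb_or => DJ.
case/andP=> /andP[d21 d1n] /andP[d2n dn] /andP[/andP[e21 e1n] /andP[e2n en]].
case/and5P=> /and3P[a11n a12n r1n] /and3P[a21n a22n r2n] c1n c2n Wn.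
case/and3P=> u1n u2n Pun cn /and3P[_ _ rn].
pose k := - (s * t) * (c * (s - t) * r) ^+ 2 * (- (s * t)^-1) * u1 * u2 * Pu ^+ 2
  * (a11 * a12 * a21 * a22 * r1 * r2 * c1 * c2 * W ^+ 2) / (d1 * d2 * d ^+ 2 * e1 * e2 * e ^+ 2).
have := congr1 ( *%R k) DJ => {DJ}.
set X := (X in k * X); set Y := (X in _ = k * X) => XY.
have nz := (s0, t0, st0, d21, d1n, d2n, dn, e21, e1n, e2n, en, a11n, a12n, r1n,
  a21n, a22n, r2n, c1n, c2n, Wn, u1n, u2n, Pun, cn, rn, oppr_eq0, oner_eq0).
rewrite [LHS](_ : _ = k * X); last by rewrite /k /X; field; rewrite ?nz.
by rewrite XY /k /Y; field; rewrite ?nz.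
Qed.
End Jacobi.

(** The partition functions enter as opaque elements [p0], ..., [p5], so the morphism is pushed
    through a small identity only; injectivity of [tofrac] pulls the relation back to the ring. *)
Lemma ik_tofrac (R : idomainType) (s t u1 u2 v1 v2 p0 p1 p2 p3 p4 p5 : R)
    (f := @tofrac R) :
  - (f s * f t) * (f u2 - f u1) * (f v2 - f v1) * f p0 * f p1
  = ik_ab (f s) (f t) (f u1) (f v2) * ik_ab (f s) (f t) (f u2) (f v1) * f p2 * f p3
    - ik_ab (f s) (f t) (f u1) (f v1) * ik_ab (f s) (f t) (f u2) (f v2) * f p4 * f p5 ->
  - (s * t) * (u2 - u1) * (v2 - v1) * p0 * p1
  = ik_ab s t u1 v2 * ik_ab s t u2 v1 * p2 * p3 - ik_ab s t u1 v1 * ik_ab s t u2 v2 * p4 * p5.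
Proof.
rewrite /ik_ab /f => E; apply/eqP; rewrite -tofrac_eq; apply/eqP; move: E.
by rewrite !(rmorphM, rmorphB, rmorphN, rmorphD, rmorph1).
Qed.

Lemma ik_rmorph (R R' : comNzRingType) (f : {rmorphism R -> R'})
    (s t u1 u2 v1 v2 p0 p1 p2 p3 p4 p5 : R) :
  - (s * t) * (u2 - u1) * (v2 - v1) * p0 * p1
  = ik_ab s t u1 v2 * ik_ab s t u2 v1 * p2 * p3
    - ik_ab s t u1 v1 * ik_ab s t u2 v2 * p4 * p5 ->
  - (f s * f t) * (f u2 - f u1) * (f v2 - f v1) * f p0 * f p1
  = ik_ab (f s) (f t) (f u1) (f v2) * ik_ab (f s) (f t) (f u2) (f v1) * f p2 * f p3
    - ik_ab (f s) (f t) (f u1) (f v1) * ik_ab (f s) (f t) (f u2) (f v2) * f p4 * f p5.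
Proof.
move/(congr1 f); rewrite /ik_ab.
by rewrite !(rmorphM, rmorphB, rmorphN, rmorphD, rmorph1).
Qed.

(** * Removal of the genericity conditions *)

Section Perturbation.
Local Arguments pfun : simpl never.
Variable K : fieldType.

(* Adding distinct powers of 'X to the parameters makes them satisfy all the nondegeneracy
   conditions of [pf_jacobi]. *)
Fixpoint perturb (k : nat) (l : seq K) : seq {poly K} :=
  if l is a :: l' then (a%:P + 'X^k) :: perturb k.+1 l' else [::].

Lemma size_perturb k l : size (perturb k l) = size l.
Proof. by elim: l k => //= a l IH k; rewrite IH. Qed.

Lemma perturb0 k l : (0 < k)%N -> map (horner_eval 0) (perturb k l) = l.
Proof.
elim: l k => //= a l IH k k0; rewrite IH // /horner_eval !hornerE expr0n gtn_eqF //.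
by rewrite addr0.
Qed.

Lemma mem_perturb k l p : p \in perturb k l ->
  exists2 i, (k <= i < k + size l)%N & p = (l`_(i - k))%:P + 'X^i.
Proof.
elim: l k => //= a l IH k; rewrite inE => /predU1P[->|/IH[i /andP[ki ik] ->]].
  by exists k; rewrite ?subnn // leqnn addnS ltnS leq_addr.
by exists i; rewrite -?(subnSK ki) // addnS -addSn ik ltnW.
Qed.

Lemma coef_perturb (a : K) i j : (0 < j)%N -> (a%:P + 'X^i)`_j = (i == j)%:R.
Proof. by move=> j0; rewrite coefD coefC gtn_eqF // add0r coefXn eq_sym. Qed.

Lemma perturb_uniq k l : uniq (perturb k l).
Proof.
elim: l k => //= a l IH k; rewrite IH andbT; apply/negP => /mem_perturb[i /andP[ki _]].
move/(congr1 (fun p : {poly K} => p`_i)); rewrite !coef_perturb ?(leq_trans _ ki) //.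
by rewrite eqxx ltn_eqF // => /esym/eqP; rewrite oner_eq0.
Qed.

Lemma perturb_lin_neq0 (c d a b : K) i j : (0 < i)%N -> i != j -> c != 0 ->
  c%:P * (a%:P + 'X^i) - d%:P * (b%:P + 'X^j) != 0.
Proof.
move=> i0 ij c0; apply/negP => /eqP/(congr1 (fun p : {poly K} => p`_i)).
rewrite coefB !coefCM !coef_perturb // eqxx eq_sym (negbTE ij) mulr0 subr0 mulr1 coef0.
by move/eqP; rewrite (negbTE c0).
Qed.

Variables (s t : K).
Hypotheses (s0 : s != 0) (t0 : t != 0) (st : s != t) (s1 : 1 + s != 0) (t1 : 1 + t != 0).
Notation pf us vs := (pfun (ik_weights s t) us vs (nseq (size us) false)).
Notation ab := (ik_ab s t).

(** The perturbed parameters satisfy the hypotheses of [pf_jacobi] over the fraction field of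
    [{poly K}]. The resulting identity lives in [{poly K}], and evaluation at 0 removes the
    perturbation. *)
Theorem pf_quadratic u1 u2 v1 v2 us vs : size us = size vs -> pf us vs != 0 ->
  - (s * t) * (u2 - u1) * (v2 - v1) * pf (u1 :: u2 :: us) (v1 :: v2 :: vs) * pf us vs
  = ab u1 v2 * ab u2 v1 * pf (u1 :: us) (v1 :: vs) * pf (u2 :: us) (v2 :: vs)
    - ab u1 v1 * ab u2 v2 * pf (u1 :: us) (v2 :: vs) * pf (u2 :: us) (v1 :: vs).
Proof.
move=> sz pf0.
(* The rows take the exponents 1 to [N - 1] and the columns those from [N] on, so none occurs
   twice. *)
pose N := (size us).+3.
pose f (l : seq {poly K}) := map (@tofrac {poly K}) l.
pose S := tofrac s%:P; pose T := tofrac t%:P.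
have pfE us' vs' m : pfun (ik_weights S T) (f us') (f vs') (nseq m false)
    = tofrac (pfun (ik_weights s%:P t%:P) us' vs' (nseq m false)).
  by rewrite rmorph_ik.
have ev us' vs' m : (pfun (ik_weights s%:P t%:P) us' vs' (nseq m false)).[0]
    = pfun (ik_weights s t) (map (horner_eval 0) us') (map (horner_eval 0) vs') (nseq m false).
  by rewrite -/(horner_eval 0 _) rmorph_ik /= /horner_eval !hornerC.
pose U1 := u1%:P + 'X^1; pose U2 := u2%:P + 'X^2; pose US := perturb 3 us.
pose V1 := v1%:P + 'X^N; pose V2 := v2%:P + 'X^(N.+1); pose VS := perturb N.+2 vs.
have US' : [:: U1, U2 & US] = perturb 1 [:: u1, u2 & us] by [].
have VS' : [:: V1, V2 & VS] = perturb N [:: v1, v2 & vs] by [].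
have tC (p q : {poly K}) : tofrac p * tofrac q = tofrac (p * q) by rewrite rmorphM.
have f_uniq l : uniq l -> uniq (f l).
  by rewrite map_inj_uniq // => p q /eqP; rewrite tofrac_eq => /eqP.
have := @pf_jacobi _ S T _ _ (tofrac U1) (tofrac U2) (tofrac V1) (tofrac V2) (f US) (f VS).
rewrite !tofrac_eq0 !polyC_eq0 => /(_ s0 t0).
rewrite !size_map !size_perturb => /(_ sz).
have := f_uniq _ (perturb_uniq 1 [:: u1, u2 & us]); rewrite -US' => Uu.
have := f_uniq _ (perturb_uniq N [:: v1, v2 & vs]); rewrite -VS' => Vu.
move=> /(_ Uu Vu) {Uu Vu}.
have A1 : {in f [:: U1, U2 & US] & f [:: V1, V2 & VS], forall u v, ik_ab S T u v != 0}.
  rewrite US' VS' => u v /mapP[_ /mem_perturb[i /andP[i1 iN] ->] ->].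
  move=> /mapP[_ /mem_perturb[j /andP[jN _] ->] ->].
  have ij : i != j by rewrite neq_ltn (leq_trans iN) // (leq_trans _ jN).
  rewrite /ik_ab mulf_neq0 //.
    by rewrite !tC -rmorphB tofrac_eq0 perturb_lin_neq0.
  rewrite -(rmorph1 (@tofrac {poly K})) -!rmorphD !tC -!rmorphB tofrac_eq0.
  by rewrite /= -!polyCM perturb_lin_neq0 // mulf_neq0.
have A2 : {in f [:: U1, U2 & US] &, forall u u', (1 + S) * u' - (1 + T) * u != 0}.
  rewrite US' => u v /mapP[_ /mem_perturb[i /andP[i1 _] ->] ->].
  move=> /mapP[_ /mem_perturb[j /andP[j1 _] ->] ->].
  rewrite -(rmorph1 (@tofrac {poly K})) -!rmorphD !tC -!rmorphB tofrac_eq0.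
  rewrite /=; have [<-|ij] := eqVneq i j; last by rewrite perturb_lin_neq0 // eq_sym.
  rewrite -mulrBl -polyCB (_ : 1 + s - (1 + t) = s - t); last by ring.
  rewrite mulf_neq0 ?polyC_eq0 ?subr_eq0 //.
  apply/negP => /eqP/(congr1 (fun p : {poly K} => p`_i)).
  by rewrite coef_perturb // eqxx coef0 => /eqP; rewrite oner_eq0.
move=> /(_ A1 A2) {A1 A2}.
rewrite pfE tofrac_eq0.
have pf0' : pfun (ik_weights s%:P t%:P) US VS (nseq (size us) false) != 0.
  apply: contraNneq pf0 => /(congr1 (horner^~ 0)); rewrite ev horner0 !perturb0 // => ->.
  by [].
move=> /(_ pf0').
rewrite /f /= !size_map !size_perturb -/f.
pose q us' vs' m := pfun (ik_weights s%:P t%:P) us' vs' (nseq m false).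
rewrite (pfE (U1 :: U2 :: US) (V1 :: V2 :: VS) (size us).+2).
rewrite (pfE (U1 :: US) (V1 :: VS) (size us).+1) (pfE (U1 :: US) (V2 :: VS) (size us).+1).
rewrite (pfE (U2 :: US) (V1 :: VS) (size us).+1) (pfE (U2 :: US) (V2 :: VS) (size us).+1).
rewrite -!/(q _ _ _) => tofrac_key.
have key : - (s%:P * t%:P) * (U2 - U1) * (V2 - V1)
      * q (U1 :: U2 :: US) (V1 :: V2 :: VS) (size us).+2
      * q US VS (size us)
    = ik_ab s%:P t%:P U1 V2 * ik_ab s%:P t%:P U2 V1
        * q (U1 :: US) (V1 :: VS) (size us).+1 * q (U2 :: US) (V2 :: VS) (size us).+1
      - ik_ab s%:P t%:P U1 V1 * ik_ab s%:P t%:P U2 V2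
        * q (U1 :: US) (V2 :: VS) (size us).+1 * q (U2 :: US) (V1 :: VS) (size us).+1.
  move: tofrac_key; rewrite /S /T.
  move: (q _ _ _) (q _ _ _) (q _ _ _) (q _ _ _) (q _ _ _) (q _ _ _) => q1 q2 q3 q4 q5 q6.
  exact: ik_tofrac.
have N0 : (0 < N)%N by [].
have evU1 : U1.[0] = u1 by rewrite !hornerE.
have evU2 : U2.[0] = u2 by rewrite !hornerE expr0n addr0.
have evV1 : V1.[0] = v1 by rewrite !hornerE expr0n addr0.
have evV2 : V2.[0] = v2 by rewrite !hornerE expr0n addr0.
have := ik_rmorph (horner_eval 0) key.
rewrite /= /horner_eval !hornerC evU1 evU2 evV1 evV2 /q !ev.
by rewrite !map_cons /horner_eval evU1 evU2 evV1 evV2 -/(horner_eval 0) !perturb0.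
Qed.

End Perturbation.

(** * The refined generating function *)

Section Scaling.
Variables (R : comPzRingType) (U V U' V' : Type).
Variables (w : weights R U V) (w' : weights R U' V').

Lemma row_op_scale d u u' c c' n r f hs :
    wa1 w u c = d * wa1 w' u' c' -> wa2 w u c = d * wa2 w' u' c' ->
    wb w u c = d * wb w' u' c' -> wcp w u c = d * wcp w' u' c' ->
    wcm w u c = d * wcm w' u' c' ->
  row_op w u (nseq n c) r f hs = d ^+ n * row_op w' u' (nseq n c') r f hs.
Proof.
move=> E1 E2 Eb Ep Em; elim: n r f hs => [|n IH] r f [|h hs] /=; rewrite ?mulr0 //.
  by rewrite expr0 mul1r.
by rewrite !IH E1 E2 Eb Ep Em exprS; case: ifP => _; case: (h); ring.
Qed.

(** Below top edges in state 0 only [wa2], [wb] and [wcp] occur, and a 1 occurs once if the row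
    starts in state 0 and never otherwise; so [g] comes out at most once. In [pf_scale] the same
    holds for the first column. *)
Lemma row_op_scale0 k g u u' c c' n r f :
    wa2 w u c = k * wa2 w' u' c' -> wb w u c = k * wb w' u' c' ->
    wcp w u c = k * g * wcp w' u' c' ->
  row_op w u (nseq n c) r f (nseq n false)
  = k ^+ n * (if r then 1 else g) * row_op w' u' (nseq n c') r f (nseq n false).
Proof.
move=> E2 Eb Ep; elim: n r f => [|n IH] r f /=.
  by case: r; rewrite ?mulr0 // expr0 !mul1r.
by rewrite !IH E2 Eb Ep exprS; case: r => /=; ring.
Qed.

Lemma pf_scale d k g u u' v v' c c' m n h hs :
    wa1 w u c = d * wa1 w' u' c' -> wa2 w u c = d * wa2 w' u' c' ->
    wb w u c = d * wb w' u' c' -> wcp w u c = d * wcp w' u' c' ->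
    wcm w u c = d * wcm w' u' c' ->
    wa2 w u v = k * wa2 w' u' v' -> wb w u v = k * wb w' u' v' ->
    wcp w u v = k * g * wcp w' u' v' ->
  pfun w (nseq m u) (v :: nseq n c) (h :: hs)
  = d ^+ (m * n) * k ^+ m * (if h then 1 else g)
    * pfun w' (nseq m u') (v' :: nseq n c') (h :: hs).
Proof.
move=> E1 E2 Eb Ep Em F2 Fb Fp; elim: m h hs => [|m IH] h hs.
  by case: h; rewrite /= ?mulr0 // expr0 !mul1r.
have rowE r h' : row_op w u (nseq n c) r
      (fun b => pfun w (nseq m u) (v :: nseq n c) (h' :: b)) hs
    = d ^+ (m.+1 * n) * k ^+ m * (if h' then 1 else g) * row_op w' u' (nseq n c') r
      (fun b => pfun w' (nseq m u') (v' :: nseq n c') (h' :: b)) hs.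
  rewrite (eq_row_op _ _ _ _ _ (IH h')) row_opZ (row_op_scale (d := d) (u' := u') (c' := c')) //.
  rewrite mulSn exprD; ring.
by case: h; rewrite /= !rowE ?Fb ?F2 ?Fp exprS; ring.
Qed.

End Scaling.

(* With row parameters z, 1, .., 1 and column parameters w, 1, .., 1, the weight u v of
   [wa2] counts the zeros to the left of the 1 of the first row by z and the zeros above
   the 1 of the first column by w. *)
Definition asm_weights (R : pzRingType) (x y : R) : weights R R R :=
  Weights (fun _ _ => x) (fun u v => u * v) (fun _ _ => 1) (fun _ _ => 1) (fun _ _ => y).

Section RefinedGF.
Variables (R : comPzRingType) (x y : R).

Definition asm_gf n (z w : R) : R :=
  if n is m.+1
  then pfun (asm_weights x y) (z :: nseq m 1) (w :: nseq m 1) (nseq n false) else 1.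

(* Sums over the matrices whose top left entry is 0, without the weight of that entry. *)
Definition asm_core m (z w : R) : R :=
  row_op (asm_weights x y) z (nseq m 1) false
    (fun hs => pfun (asm_weights x y) (nseq m 1) (w :: nseq m 1) (false :: hs)) (nseq m false).

Lemma asm_gf1 n : asm_gf n 1 1 = pfun (asm_weights x y) (nseq n 1) (nseq n 1) (nseq n false).
Proof. by case: n. Qed.

(** The top left entry is 0, with weight [z * w], or it is 1; then the first row and column are
    frozen with weight 1 and an ASM of size [m] remains. *)
Lemma asm_gfS m z w : asm_gf m.+1 z w = z * w * asm_core m z w + asm_gf m 1 1.
Proof.
rewrite asm_gf1 /= /asm_core; congr (_ + _); rewrite mul1r.
have {1}-> : nseq m false = nseq (size (nseq m (1 : R))) false by rewrite size_nseq.
by rewrite row_op_true_zeros size_nseq pf_column_true /= !big1 ?mul1r.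
Qed.

End RefinedGF.

(** * From the quadratic relation to refined generating functions *)

Section KeyRelation.
Variables (K : fieldType) (s t : K).
Hypotheses (s0 : s != 0) (t0 : t != 0) (st : s != t) (s1 : 1 + s != 0) (t1 : 1 + t != 0).
Notation x := ((1 + s) * (1 + t)).
Notation y := (s * t).
Notation A u v := (s * u - t * v).
Notation B u v := (s * (1 + t) * u - t * (1 + s) * v).
Notation gf := (asm_gf x y).
Notation core := (asm_core x y).
Notation pf := (pfun (ik_weights s t)).

Lemma ik_hom m : pf (nseq m 1) (nseq m 1) (nseq m false) = (s - t) ^+ (m * m) * gf m 1 1.
Proof.
case: m => [|m]; first by rewrite /= expr0 mul1r.
rewrite (@pf_scale _ _ _ _ _ _ (asm_weights x y) (s - t) (s - t) 1 _ 1 _ 1 _ 1) /=;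
  try ring.
by rewrite !mulr1 -exprD -mulnSr.
Qed.

(** Dividing the first row by [b] and the first column by [b'] turns [wb] into 1 and [wa2] into [z]
    and [w]; their 1s leave the factors [(s - t) * xi / b] and [(s - t) / b']. The corner lies on
    both lines and its weight [A xi eta] does not split accordingly, so its two cases are kept apart
    and [core] appears instead of [gf]. *)
Lemma ik_refined m xi eta z w (b := B xi 1) (b' := B 1 eta) : b != 0 -> b' != 0 ->
    A xi 1 = z * b -> A 1 eta = w * b' ->
  pf (xi :: nseq m 1) (eta :: nseq m 1) (nseq m.+1 false)
  = (s - t) ^+ (m * m).+1 * xi * (b * b') ^+ m
    * (gf m 1 1 + (s - t) * A xi eta / (b * b') * core m z w).
Proof.
move=> b0 b'0 zE wE; rewrite /=.
have -> f : row_op (ik_weights s t) xi (nseq m 1) false f (nseq m false)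
    = b ^+ m * ((s - t) * xi / b) * row_op (asm_weights x y) z (nseq m 1) false f (nseq m false).
  apply: (@row_op_scale0 _ _ _ _ _ _ _ b ((s - t) * xi / b) _ _ _ _ m false) => /=;
    [by rewrite zE mulr1 mulrC | by rewrite [RHS]mulr1 | by field].
have -> f : row_op (ik_weights s t) xi (nseq m 1) true f (nseq m false)
    = b ^+ m * row_op (asm_weights x y) z (nseq m 1) true f (nseq m false).
  rewrite -[b ^+ m]mulr1.
  apply: (@row_op_scale0 _ _ _ _ _ _ _ b ((s - t) * xi / b) _ _ _ _ m true) => /=;
    [by rewrite zE mulr1 mulrC | by rewrite [RHS]mulr1 | by field].
have colE h hs : pf (nseq m 1) (eta :: nseq m 1) (h :: hs)
   = (s - t) ^+ (m * m) * b' ^+ m * (if h then 1 else (s - t) / b')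
     * pfun (asm_weights x y) (nseq m 1) (w :: nseq m 1) (h :: hs).
  apply: pf_scale => /=; try ring;
    [by rewrite wE mul1r mulrC | by rewrite [RHS]mulr1 | by field].
rewrite (eq_row_op _ _ _ _ _ (colE false)) (eq_row_op _ _ _ _ _ (colE true)) !row_opZ.
rewrite -/(asm_core _ _ _ _ _).
(* At z = w = 0 only the matrices with top left entry 1 survive. *)
have := asm_gfS x y m 0 0; rewrite mul0r mul0r add0r asm_gf1 => <-.
rewrite /= mulr0 mul0r add0r.
have -> : row_op (asm_weights x y) 0 (nseq m 1) true
   (fun t0 => pfun (asm_weights x y) (nseq m 1) (0 :: nseq m 1) (true :: t0)) (nseq m false)
  = row_op (asm_weights x y) z (nseq m 1) true
   (fun t0 => pfun (asm_weights x y) (nseq m 1) (w :: nseq m 1) (true :: t0)) (nseq m false).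
  have E : nseq m false = nseq (size (nseq m (1 : K))) false by rewrite size_nseq.
  by rewrite !E !row_op_true_zeros !pf_column_true.
by rewrite exprMn exprS; field; rewrite b0 b'0.
Qed.

Local Arguments pfun : simpl never.

(** This is [pf_quadratic] with rows [xi], 1, ..., 1 and columns [eta], 1, ..., 1. The conditions on
    z and w make [xi] and [eta] defined and [xi] nonzero, and the joint one says that [A xi eta], by
    which the relation is divided, is nonzero. *)
Lemma asm_core_relation p z w :
    1 - z * (1 + t) != 0 -> 1 - z * (1 + s) != 0 -> 1 - w * (1 + s) != 0 ->
    t * (1 - z * (1 + s)) * (1 - w * (1 + s))
      - s * (1 - z * (1 + t)) * (1 - w * (1 + t)) != 0 ->
    gf p 1 1 != 0 ->
  (1 - z) * (1 - w) * core p.+1 z w * gf p 1 1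
  = y * gf p.+1 1 1 * gf p.+1 z w
    + (x * (1 - z) * (1 - w) - y) * gf p.+1 z 1 * gf p.+1 1 w.
Proof.
move=> z1 z2 w1 zw1 gf0.
have d0 : s - t != 0 by rewrite subr_eq0.
(* The values of the row and column parameters for which [ik_refined] applies. *)
pose xi := t * (1 - z * (1 + s)) / (s * (1 - z * (1 + t))).
pose eta := s * (1 - w * (1 + t)) / (t * (1 - w * (1 + s))).
have xi0 : xi != 0 by rewrite !mulf_neq0 ?invr_eq0 ?mulf_neq0.
have bE : B xi 1 = - t * (s - t) / (1 - z * (1 + t)) by rewrite /xi; field; rewrite ?s0 ?z1.
have b'E : B 1 eta = - s * (s - t) / (1 - w * (1 + s)) by rewrite /eta; field; rewrite ?t0 ?w1.
have aE : A xi 1 = z * B xi 1 by rewrite bE /xi; field; rewrite ?s0 ?z1.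
have a'E : A 1 eta = w * B 1 eta by rewrite b'E /eta; field; rewrite ?t0 ?w1.
have b0 : B xi 1 != 0 by rewrite bE !mulf_neq0 ?invr_eq0 ?oppr_eq0.
have b'0 : B 1 eta != 0 by rewrite b'E !mulf_neq0 ?invr_eq0 ?oppr_eq0.
have b1E : B 1 1 = s - t by ring.
have a1E : A 1 1 = 1 * B 1 1 by ring.
have b10 : B 1 1 != 0 by rewrite b1E.
have J : - (s * t) * (1 - xi) * (1 - eta)
      * pf (xi :: nseq p.+1 1) (eta :: nseq p.+1 1) (nseq p.+2 false)
      * pf (nseq p 1) (nseq p 1) (nseq p false)
    = ik_ab s t xi 1 * ik_ab s t 1 eta * pf (xi :: nseq p 1) (eta :: nseq p 1) (nseq p.+1 false)
        * pf (nseq p.+1 1) (nseq p.+1 1) (nseq p.+1 false)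
      - ik_ab s t xi eta * ik_ab s t 1 1 * pf (xi :: nseq p 1) (1 :: nseq p 1) (nseq p.+1 false)
        * pf (1 :: nseq p 1) (eta :: nseq p 1) (nseq p.+1 false).
  have := pf_quadratic s0 t0 st s1 t1 xi 1 eta 1 (us := nseq p 1) (vs := nseq p 1) erefl.
  by rewrite /= !size_nseq ik_hom mulf_neq0 ?expf_neq0 //; apply.
move: J; rewrite !ik_hom (ik_refined p.+1 b0 b'0 aE a'E).
rewrite (ik_refined p b0 b'0 aE a'E) (ik_refined p b0 b10 aE a1E) (ik_refined p b10 b'0 a1E a'E).
rewrite !asm_gfS !b1E.
have E1 : (s - t) ^+ (p.+1 * p.+1) = (s - t) ^+ (p * p) * (s - t) ^+ p * (s - t) ^+ p * (s - t).
  by rewrite mulnSr mulSnr addnS exprSr !exprD.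
rewrite [_ ^+ (p.+1 * p.+1).+1]exprS !E1 {E1} ![_ ^+ (p * p).+1]exprS ![_ ^+ p.+1]exprS !exprMn.
have : (s - t) ^+ (p * p) != 0 by rewrite expf_neq0.
have : (s - t) ^+ p != 0 by rewrite expf_neq0.
have : B xi 1 ^+ p != 0 by rewrite expf_neq0.
have : B 1 eta ^+ p != 0 by rewrite expf_neq0.
rewrite /ik_ab aE a'E; move: (_ ^+ p) (_ ^+ p) (_ ^+ p) (_ ^+ (p * p)) => P' P D E P'0 P0 D0 E0.
have a0 : A xi eta = (t * (1 - z * (1 + s)) * (1 - w * (1 + s))
   - s * (1 - z * (1 + t)) * (1 - w * (1 + t))) / ((1 - z * (1 + t)) * (1 - w * (1 + s))).
  by rewrite /xi /eta; field; rewrite ?s0 ?t0 ?z1 ?w1.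
move=> J; have {J} : - y * (1 - xi) * (1 - eta) * (B xi 1 * B 1 eta)
      * (core p 1 1 + gf p 1 1 + (s - t) * A xi eta / (B xi 1 * B 1 eta) * core p.+1 z w)
      * gf p 1 1
    = z * B xi 1 ^+ 2 * (w * B 1 eta ^+ 2)
      * (gf p 1 1 + (s - t) * A xi eta / (B xi 1 * B 1 eta) * core p z w)
      * (core p 1 1 + gf p 1 1)
      - A xi eta * B xi eta * (s - t) ^+ 2
        * (gf p 1 1 + z * core p z 1) * (gf p 1 1 + w * core p 1 w).
  have c0 : (s - t) ^+ 2 * E ^+ 2 * P' ^+ 2 * P * D * xi != 0.
    by rewrite mulf_neq0 // !mulf_neq0 ?expf_neq0.
  apply: (mulfI c0); move: J; move: b0 b'0; rewrite a1E b1E.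
  move: (B xi 1) (B 1 eta) (A xi eta) (B xi eta) => b b' a a2 nb nb' J.
  transitivity (- y * (1 - xi) * (1 - eta) *
   ((s - t) * (E * P' * P' * (s - t)) * xi * (b * b' * (P * D)) *
    (1 * 1 * core p 1 1 + gf p 1 1 +
     (s - t) * a / (b * b') * core p.+1 z w)) *
   (E * gf p 1 1)); first by ring.
  by rewrite J; field; rewrite ?nb ?nb' ?d0.
have -> : B xi eta = B xi 1 + t * (1 + s) * (1 - eta) by ring.
rewrite a0 bE b'E.
move: (core p 1 1) (core p z 1) (core p 1 w) (core p z w) (core p.+1 z w) gf0.
move: (gf p 1 1) => Z Y1 Yz Yw Yzw Yn Z0 J.
pose N := t * (1 - z * (1 + s)) * (1 - w * (1 + s)) - s * (1 - z * (1 + t)) * (1 - w * (1 + t)).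
(* The difference of the two sides of the goal is [k] times that of [J]. *)
pose k := (1 - z * (1 + t)) ^+ 2 * (1 - w * (1 + s)) ^+ 2 / ((s - t) ^+ 3 * N).
move: J => /(congr1 ( *%R k)) J; apply/eqP; rewrite -subr_eq0; apply/eqP.
transitivity (k * 0); last by rewrite mulr0.
move/eqP: J; rewrite -subr_eq0 -mulrBr => /eqP; rewrite mulr0 => <-.
by rewrite /k /N /xi /eta; field; rewrite ?oppr_eq0 ?s0 ?t0 ?z1 ?w1 ?d0 ?zw1.
Qed.

End KeyRelation.

(** * Alternating sign matrices as states of the model *)

Definition entries : seq int := [:: 0; 1; -1].

Lemma entriesP (a : int) : mem entries a -> [\/ a = 0, a = 1 | a = -1].
Proof.
by rewrite /= !inE => /or3P[]/eqP->; [constructor 1 | constructor 2 | constructor 3].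
Qed.

Definition edge_ok (r : bool) (a : int) : bool := (a == 0) || (a == if r then -1 else 1).
Definition edge_next (r : bool) (a : int) : bool := if a == 0 then r else a == 1.

(* All partial sums of the line, started from [r], are 0 or 1, and the total is 1. *)
Fixpoint line_ok (r : bool) (s : seq int) : bool :=
  if s is a :: s' then edge_ok r a && line_ok (edge_next r a) s' else r.

(** The state remembers the last nonzero entry, 1 if [r] holds and -1 otherwise; a line started in
    state 0 behaves as if preceded by -1, so its first nonzero entry is 1. *)
Lemma line_ok_path r s : all (mem entries) s ->
  line_ok r s = path (fun a b : int => a * b < 0) (if r then 1 else -1) [seq a <- s | a != 0]
                && (\sum_(a <- s) a == 1 - r%:R).
Proof.
elim: s r => [|a s IH] r; first by rewrite big_nil; case: r.
rewrite big_cons => /andP[a_e s_e].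
have {}IH r' := IH r' s_e.
by case: (entriesP a_e) => ->; case: r; rewrite /= ?IH //= ?add0r //;
  congr (_ && _); apply/eqP/eqP => ?; lia.
Qed.

(** Serves to exclude a first nonzero entry -1, which alternation alone permits: such a line would
    have sum -1 or 0. *)
Lemma path_sum (e : int) s : e \in [:: 1; -1] -> all (mem entries) s ->
  path (fun a b : int => a * b < 0) e [seq a <- s | a != 0] ->
  (\sum_(a <- s) a == 0) || (\sum_(a <- s) a == - e).
Proof.
elim: s e => [|a s IH] e e_1; first by rewrite big_nil.
rewrite big_cons => /andP[a_e s_e].
case: (entriesP a_e) => ->; rewrite ?add0r /=; first exact: IH.
  case/andP=> e_neg /(IH 1 isT s_e); move: e_1 e_neg; rewrite !inE => /orP[]/eqP-> // _.
  by case/orP=> /eqP->.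
case/andP=> e_neg /(IH (-1) isT s_e); move: e_1 e_neg; rewrite !inE => /orP[]/eqP-> // _.
by case/orP=> /eqP->.
Qed.

Lemma alternating_lineE s : all (mem entries) s -> alternating_line s = line_ok false s.
Proof.
move=> s_e; rewrite line_ok_path // subr0 /alternating_line.
have [s1|] := eqVneq; last by rewrite !andbF.
rewrite !andbT; elim: s s_e s1 => [//|a s IH]; rewrite big_cons => /andP[a_e s_e].
case: (entriesP a_e) => ->; rewrite /= ?add0r; first exact: IH.
  by [].
move=> s1; apply/negP => /path_sum -/(_ isT s_e) /orP[]/eqP s2; by move: s1; rewrite s2.
Qed.

Definition edge_state (r : bool) (s : seq int) (j : nat) : bool := foldl edge_next r (take j s).

Lemma line_okE r s : line_ok r s
  = all (fun j => edge_ok (edge_state r s j) s`_j) (iota 0 (size s)) && edge_state r s (size s).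
Proof.
rewrite /edge_state take_size; elim: s r => [//|a s IH] r /=.
by rewrite IH andbA -add1n iotaDl all_map.
Qed.

Lemma edge_state_sum r s j : line_ok r s -> (j <= size s)%N ->
  (edge_state r s j)%:R = r%:R + \sum_(a <- take j s) a :> int.
Proof.
rewrite /edge_state; elim: s r j => [|a s IH] r [|j] //=; rewrite ?big_nil ?addr0 //.
case/andP=> a_ok s_ok jn; rewrite IH // big_cons addrA; congr (_ + _).
move: a_ok {s_ok}; rewrite /edge_ok /edge_next; case: eqP => [->|_]; rewrite ?addr0 //= => /eqP->.
by case: r.
Qed.

(** * Expansion of the transfer operators over tables of entries *)

Section StateSum.
Variables (R : comPzRingType) (U V : Type) (w : weights R U V).

(** The value 0 for forbidden entries lets the sums below run over all tables of entries. *)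
Definition vertex_wt u v (h r : bool) (a : int) : R :=
  if edge_ok h a && edge_ok r a then
    if a == 0 then if h == r then if h then wa1 w u v else wa2 w u v else wb w u v
    else if h then wcm w u v else wcp w u v
  else 0.

Fixpoint words (n : nat) : seq (seq int) :=
  if n is m.+1 then [seq a :: s | a <- entries, s <- words m] else [:: [::]].

Fixpoint tables (m n : nat) : seq (seq (seq int)) :=
  if m is k.+1 then [seq a :: L | a <- words n, L <- tables k n] else [:: [::]].

Fixpoint row_wt u vs (r : bool) (hs : seq bool) (s : seq int) : R :=
  match vs, hs, s with
  | v :: vs', h :: hs', a :: s' => vertex_wt u v h r a * row_wt u vs' (edge_next r a) hs' s'
  | [::], [::], [::] => r%:R
  | _, _, _ => 0
  end.

Definition next_row (hs : seq bool) (s : seq int) := [seq edge_next p.1 p.2 | p <- zip hs s].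

Lemma row_op_words n u vs r f hs : size vs = n -> size hs = n ->
  row_op w u vs r f hs = \sum_(s <- words n) row_wt u vs r hs s * f (next_row hs s).
Proof.
elim: n vs r f hs => [|n IH] [|v vs] r f [|h hs] //=.
  by rewrite big_seq1; case: r; rewrite ?mul1r ?mul0r.
move=> [vsn] [hsn]; rewrite cats0 !big_cat !big_map /=.
rewrite (IH vs) // (IH vs) // !(eq_bigr _ (fun _ _ => esym (mulrA _ _ _))) -!mulr_sumr /next_row /=.
by rewrite /vertex_wt /edge_ok; case: h r => -[] /=; rewrite ?mul0r ?addr0 ?add0r.
Qed.

Fixpoint table_wt us vs hs (L : seq (seq int)) : R :=
  match us, L with
  | u :: us', s :: L' => row_wt u vs false hs s * table_wt us' vs (next_row hs s) L'
  | [::], [::] => (all id hs)%:R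
  | _, _ => 0
  end.

Lemma wordsS n : words n.+1 = [seq a :: s | a <- entries, s <- words n].
Proof. by []. Qed.

Lemma words_size n s : s \in words n -> size s = n.
Proof.
elim: n s => [|n IH] s; first by rewrite inE => /eqP->.
by rewrite wordsS => /allpairsP[[a s'] /= [_ /IH <- ->]].
Qed.

Lemma pf_tables m n us vs hs : size us = m -> size vs = n -> size hs = n ->
  pfun w us vs hs = \sum_(L <- tables m n) table_wt us vs hs L.
Proof.
elim: m us hs => [|m IH] [|u us] hs //=; first by rewrite big_seq1.
move=> [usm] vsn hsn; rewrite (row_op_words (n := n)) // big_allpairs_dep big_seq [RHS]big_seq.
apply: eq_bigr => s /words_size s_n; rewrite IH // ?mulr_sumr //.
by rewrite size_map size_zip hsn s_n minnn.
Qed.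

End StateSum.

Lemma sum_take (s : seq int) j :
  \sum_(a <- take j s) a = \sum_(0 <= i < size s | (i < j)%N) s`_i.
Proof.
rewrite [RHS]big_mkcond; elim: s j => [|a s IH] [|j] /=; rewrite ?big_nil //.
  by rewrite big1.
by rewrite /= big_cons big_nat_recl //= IH.
Qed.

Section ProductFormula.
Variables (R : comPzRingType) (U V : Type) (w : weights R U V) (u0 : U) (v0 : V).

Lemma row_wtE n u vs r hs s : size vs = n -> size hs = n -> size s = n ->
  row_wt w u vs r hs s
  = \prod_(0 <= j < n) vertex_wt w u (nth v0 vs j) (nth false hs j) (edge_state r s j) s`_j
    * (edge_state r s n)%:R.
Proof.
elim: n vs r hs s => [|n IH] [|v vs] r [|h hs] [|a s] //=.
  by rewrite big_geq // mul1r.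
by move=> [vsn] [hsn] [sn]; rewrite IH // big_nat_recl //= mulrA.
Qed.

Lemma table_wtE m n us vs hs (L : seq (seq int)) : size us = m -> size L = m ->
    size vs = n -> size hs = n -> all (fun s => size s == n) L ->
    let h i j := edge_state (nth false hs j) [seq s`_j | s <- L] i in
    let r i j := edge_state false (nth [::] L i) j in
  table_wt w us vs hs L
  = \prod_(0 <= i < m)
      (\prod_(0 <= j < n) vertex_wt w (nth u0 us i) (nth v0 vs j) (h i j) (r i j) (nth [::] L i)`_j
        * (r i n)%:R)
    * \prod_(0 <= j < n) (h m j)%:R.
Proof.
move=> usm Lm vsn hsn Ln h r; rewrite {}/h {}/r.
elim: m us hs L usm Lm hsn Ln => [|m IH] [|u us] hs [|s L] //=.
  move=> _ _ hsn _; rewrite big_geq // mul1r /edge_state /=.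
  rewrite -hsn; elim: hs {hsn} => [|h hs IH]; first by rewrite big_geq.
  by rewrite /= big_nat_recl //= -IH; case: h; rewrite ?mul1r ?mul0r.
move=> [usm] [Lm] hsn /andP[/eqP sn Ln].
rewrite (row_wtE (n := n)) // IH // ?size_map ?size_zip ?hsn ?sn ?minnn //.
rewrite big_nat_recl //= -[RHS]mulrA; congr (_ * _).
have nextE j : (j < n)%N -> nth false (next_row hs s) j = edge_next (nth false hs j) s`_j.
  by move=> jn; rewrite (nth_map (false, 0)) ?size_zip ?hsn ?sn ?minnn // nth_zip //= hsn.
congr (_ * _); last by apply: eq_big_nat => j /andP[_ jn]; rewrite nextE.
apply: eq_big_nat => i _; congr (_ * _); apply: eq_big_nat => j /andP[_ jn].
by rewrite nextE.
Qed.

End ProductFormula.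

Section MatrixStates.
Variable n : nat.
Implicit Type A : 'M[int]_n.

Definition mx_row A i : seq int := [seq A i j | j <- enum 'I_n].
Definition row_state A (i j : 'I_n) : bool := edge_state false (mx_row A i) j.

Definition asm_mx A := (forall i j, A i j \in entries)
  /\ (forall i, line_ok false (mx_row A i)) /\ (forall j, line_ok false (mx_row A^T j)).

Lemma nth_mx_row A i (j : 'I_n) : (mx_row A i)`_j = A i j.
Proof. by rewrite (nth_map j) ?size_enum_ord // nth_ord_enum. Qed.

Lemma size_mx_row A i : size (mx_row A i) = n.
Proof. by rewrite size_map size_enum_ord. Qed.

Lemma mx_row_entries A i : (forall i j, A i j \in entries) -> all (mem entries) (mx_row A i).
Proof. by move=> A_e; apply/allP => _ /mapP[j _ ->]; exact: A_e. Qed.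

Lemma is_asmP A : reflect (asm_mx A) (is_asm A).
Proof.
have trE j : [seq A i j | i <- enum 'I_n] = mx_row A^T j.
  by apply: eq_map => i; rewrite mxE.
have e_tr : (forall i j, A i j \in entries) -> forall i j, A^T i j \in entries.
  by move=> A_e i j; rewrite mxE.
apply: (iffP and3P) => [[/forallP A_e /forallP rows /forallP cols]|[A_e [rows cols]]].
  have {}A_e i j : A i j \in entries by have /forallP := A_e i; apply.
  split=> //; split=> i; first by rewrite -alternating_lineE ?mx_row_entries //; exact: rows.
  rewrite -alternating_lineE; first by rewrite -trE; exact: cols.
  exact/mx_row_entries/e_tr.
split; first by apply/forallP => i; apply/forallP => j; exact: A_e.
  by apply/forallP => i; rewrite alternating_lineE; [exact: rows | exact: mx_row_entries].
apply/forallP => j; rewrite trE alternating_lineE; first exact: cols.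
exact/mx_row_entries/e_tr.
Qed.

Lemma row_state_sum A i j : asm_mx A ->
  (row_state A i j)%:R = \sum_(k < n | (k < j)%N) A i k :> int.
Proof.
case=> _ [rows _]; rewrite edge_state_sum ?size_mx_row 1?ltnW // add0r sum_take size_mx_row.
by rewrite big_mkord; apply: eq_bigr => k _; rewrite nth_mx_row.
Qed.

Lemma row_edge_ok A i j : asm_mx A -> edge_ok (row_state A i j) (A i j).
Proof.
case=> _ [rows _]; have := rows i; rewrite line_okE size_mx_row => /andP[/allP/(_ j)].
by rewrite mem_iota /= => /(_ (ltn_ord j)); rewrite nth_mx_row.
Qed.

Lemma asm_mx_tr A : asm_mx A -> asm_mx A^T.
Proof.
by case=> A_e [rows cols]; split=> [i j|]; rewrite ?mxE //; split=> // j; rewrite trmxK.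
Qed.

(* The number of vertices of type [wa1], i.e. the inversion number. *)
Definition crossings A : nat :=
  (\sum_(i < n) \sum_(j < n) (row_state A i j && row_state A^T j i && (A i j == 0%R)))%N.

Lemma crossings_tr A : crossings A^T = crossings A.
Proof.
rewrite /crossings exchange_big; apply: eq_bigr => i _; apply: eq_bigr => j _.
by rewrite trmxK mxE [row_state _ _ _ && _]andbC.
Qed.

(** Summing over the upper row index and the left column index turns [nu] into a sum of column state
    times (row state + entry). Where the column state is 1 the entry is 0 or -1, and -1 requires row
    state 1, so each summand is the indicator of a [wa1] vertex. *)
Lemma nu_crossings A : asm_mx A -> nu A = (crossings A)%:Z.
Proof.
move=> asmA; rewrite /nu /crossings.
transitivity (\sum_(i < n) \sum_(j < n) (row_state A^T j i)%:R * ((row_state A i j)%:R + A i j)).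
  rewrite (exchange_big_dep predT) //=; apply: eq_bigr => i _.
  rewrite exchange_big; apply: eq_bigr => j _ /=.
  rewrite (row_state_sum _ _ (asm_mx_tr asmA)) mulr_suml; apply: eq_bigr => i' _.
  rewrite mxE -mulr_sumr; congr (_ * _); rewrite (bigD1 j) //= addrC; congr (_ + _).
  rewrite row_state_sum //; apply: eq_bigl => j'.
  by rewrite andbC ltn_neqAle.
rewrite -[RHS]natz natr_sum; apply: eq_bigr => i _; rewrite natr_sum; apply: eq_bigr => j _.
have := row_edge_ok i j asmA; have := row_edge_ok j i (asm_mx_tr asmA); rewrite mxE /edge_ok.
by case: (row_state A i j) (row_state A^T j i) => -[]; case: eqP => [->|_] //= => /eqP-> //.
Qed.

End MatrixStates.

Lemma mem_words n s : (s \in words n) = (size s == n) && all (mem entries) s.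
Proof.
elim: n s => [|n IH] [|a s]; rewrite ?inE // wordsS.
  by apply/allpairsP => -[[b s'] [_ _]].
apply/allpairsP/idP => [[[b s'] [b_e]]|/andP[sn /andP[a_e s_e]]] /=.
  by rewrite IH => /andP[s'n s'_e] [-> ->]; rewrite eqSS s'n s'_e andbT.
by exists (a, s); split=> //; rewrite IH -eqSS sn.
Qed.

Lemma tablesS m n : tables m.+1 n = [seq a :: L | a <- words n, L <- tables m n].
Proof. by []. Qed.

Lemma mem_tables m n L : (L \in tables m n) = (size L == m) && all (mem (words n)) L.
Proof.
elim: m L => [|m IH] [|s L]; rewrite ?inE // tablesS.
  by apply/allpairsP => -[[b s'] [_ _]].
apply/allpairsP/idP => [[[b s'] [b_e]]|/andP[sn /andP[a_e s_e]]] /=.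
  by rewrite IH => /andP[s'n s'_e] [-> ->]; rewrite eqSS s'n s'_e andbT.
by exists (s, L); split=> //; rewrite IH -eqSS sn.
Qed.

Lemma words_uniq n : uniq (words n).
Proof.
elim: n => [//|n IH]; rewrite wordsS allpairs_uniq //.
by move=> [a s] [b s'] _ _ /= [-> ->].
Qed.

Lemma tables_uniq m n : uniq (tables m n).
Proof.
elim: m => [//|m IH]; rewrite tablesS allpairs_uniq ?words_uniq //.
by move=> [a s] [b s'] _ _ /= [-> ->].
Qed.

Definition mx_rows n (A : 'M[int]_n) := [seq mx_row A i | i <- enum 'I_n].

Lemma nth_mx_rows n (A : 'M[int]_n) (i : 'I_n) : nth [::] (mx_rows A) i = mx_row A i.
Proof. by rewrite (nth_map i) ?size_enum_ord // nth_ord_enum. Qed.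

Lemma size_mx_rows n (A : 'M[int]_n) : size (mx_rows A) = n.
Proof. by rewrite size_map size_enum_ord. Qed.

Lemma int_mx_entries n (A : 'M[asm_entry]_n) i j : int_mx A i j \in entries.
Proof. by rewrite mxE; exact: ssvalP. Qed.

Lemma tables_perm n :
  perm_eq (tables n n) [seq mx_rows (int_mx A) | A : 'M[asm_entry]_n].
Proof.
apply: uniq_perm; first exact: tables_uniq.
  rewrite map_inj_uniq ?enum_uniq // => A B AB; apply/matrixP => i j; apply: val_inj.
  have := congr1 (fun L => (nth [::] L i)`_j) AB.
  by rewrite /= !nth_mx_rows !nth_mx_row !mxE.
move=> L; rewrite mem_tables; apply/andP/mapP => [[/eqP Ln /allP L_w]|[A _ ->]]; last first.
  rewrite size_map size_enum_ord eqxx; split=> //.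
  apply/allP => _ /mapP[i _ ->] /=; rewrite mem_words size_mx_row eqxx /=.
  by apply: mx_row_entries; exact: int_mx_entries.
have rowP (i : 'I_n) : size (nth [::] L i) = n /\ all (mem entries) (nth [::] L i).
  have : nth [::] L i \in words n by apply: L_w; rewrite mem_nth // Ln.
  by rewrite mem_words => /andP[/eqP].
exists (\matrix_(i, j) insubd (SeqSub (mem_head 0 [:: 1; -1 : int]) : asm_entry) (nth [::] L i)`_j).
  by rewrite mem_enum.
apply: (eq_from_nth (x0 := [::])); first by rewrite size_map size_enum_ord.
move=> i; rewrite Ln => lt_i; have [szi ei] := rowP (Ordinal lt_i).
rewrite (nth_mx_rows _ (Ordinal lt_i)); apply: (eq_from_nth (x0 := 0)).
  by rewrite size_mx_row.
move=> j; rewrite szi => lt_j; rewrite (nth_mx_row _ _ (Ordinal lt_j)) !mxE val_insubd.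
by rewrite ifT //; apply: (allP ei); rewrite mem_nth // szi.
Qed.

Section StateSumASM.
Variables (R : comPzRingType) (U V : Type) (w : weights R U V) (u0 : U) (v0 : V).

(** A line that is not admissible either has an entry in conflict with an edge state, so that its
    [vertex_wt] is 0, or ends in state 0; both make the product vanish. *)
Lemma table_wt_mx n us vs (A : 'M[int]_n) : size us = n -> size vs = n ->
    (forall i j, A i j \in entries) ->
  table_wt w us vs (nseq n false) (mx_rows A)
  = if is_asm A then \prod_(i < n) \prod_(j < n)
      vertex_wt w (nth u0 us i) (nth v0 vs j) (row_state A^T j i) (row_state A i j) (A i j)
    else 0.
Proof.
move=> usn vsn A_e.
have A_eT i j : A^T i j \in entries by rewrite mxE.
rewrite (table_wtE _ u0 v0 (m := n) (n := n)) ?size_nseq ?size_mx_rows //; last first.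
  by apply/allP => _ /mapP[i _ ->]; rewrite size_mx_row.
rewrite !big_mkord.
have colE (j : 'I_n) : [seq s`_j | s <- mx_rows A] = mx_row A^T j.
  by rewrite -map_comp; apply: eq_map => i /=; rewrite nth_mx_row mxE.
have -> : \prod_(j < n) (edge_state (nth false (nseq n false) j) [seq s`_j | s <- mx_rows A] n)%:R
    = \prod_(j < n) (edge_state false (mx_row A^T j) n)%:R :> R.
  by apply: eq_bigr => j _; rewrite nth_nseq ltn_ord colE.
rewrite (eq_bigr (fun i : 'I_n => \prod_(j < n)
      vertex_wt w (nth u0 us i) (nth v0 vs j) (row_state A^T j i) (row_state A i j) (A i j)
     * (edge_state false (mx_row A i) n)%:R)); last first.
  move=> i _; rewrite nth_mx_rows big_mkord; congr (_ * _); apply: eq_bigr => j _.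
  by rewrite nth_nseq ltn_ord colE nth_mx_row.
have [[_ [rows cols]]|nasm] := is_asmP.
  rewrite [X in _ * X]big1 ?mulr1 => [|j _]; last first.
    by have := cols j; rewrite line_okE size_mx_row => /andP[_ ->].
  apply: eq_bigr => i _.
  by have := rows i; rewrite line_okE size_mx_row => /andP[_ ->]; rewrite mulr1.
have bad_line (B : 'M[int]_n) i : ~~ line_ok false (mx_row B i) ->
    (exists j, ~~ edge_ok (row_state B i j) (B i j)) \/ ~~ edge_state false (mx_row B i) n.
  rewrite line_okE size_mx_row negb_and => /orP[/allPn[j]|]; last by right.
  rewrite mem_iota => /= jn bad; left; exists (Ordinal jn).
  by rewrite -[B i _](nth_mx_row B i).
have zero (a b c d : R) : a = 0 -> a * b * c * d = 0 by move=> ->; rewrite !mul0r.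
have [/forallP rows|] := boolP [forall i, line_ok false (mx_row A i)].
  have [/forallP cols|/forallPn[j /bad_line[[i bad]|bad]]] :=
    boolP [forall j, line_ok false (mx_row A^T j)].
  - by case: nasm.
  - rewrite (bigD1 i) //= !zero // (bigD1 j) //= {1}/vertex_wt.
    by move: bad; rewrite mxE => /negbTE->; rewrite mul0r.
  by rewrite [X in _ * X](bigD1 j) //= (negbTE bad) mul0r mulr0.
case/forallPn=> i /bad_line[[j bad]|bad].
  rewrite (bigD1 i) //= !zero // (bigD1 j) //= {1}/vertex_wt.
  by rewrite (negbTE bad) andbF mul0r.
by rewrite (bigD1 i) //= (negbTE bad) mulr0 !mul0r.
Qed.

Lemma pf_asm n us vs : size us = n -> size vs = n ->
  pfun w us vs (nseq n false) = \sum_(A in ASM n) \prod_(i < n) \prod_(j < n)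
    vertex_wt w (nth u0 us i) (nth v0 vs j)
      (row_state (int_mx A)^T j i) (row_state (int_mx A) i j) (int_mx A i j).
Proof.
move=> usn vsn; rewrite (pf_tables w (m := n) (n := n)) ?size_nseq //.
rewrite (perm_big _ (tables_perm n)) big_map big_enum /= [RHS]big_mkcond.
apply: eq_bigr => A _; rewrite table_wt_mx ?inE // => i j; exact: int_mx_entries.
Qed.

End StateSumASM.

(** * The ASM statistics as vertex counts *)

Section Statistics.
Variables (n : nat) (A : 'M[int]_n).
Hypothesis asmA : asm_mx A.

Lemma asm_row_sum i : \sum_(k < n) A i k = 1.
Proof.
have [_ [rows _]] := asmA; have := edge_state_sum (rows i) (leqnn _).
have := rows i; rewrite line_okE => /andP[_ ->]; rewrite take_size add0r => E.
by move: E; rewrite /mx_row big_map big_enum /= => <-.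
Qed.

Lemma top_entry (i j : 'I_n) : val i = 0%N -> A i j = 0 \/ A i j = 1.
Proof.
move=> i0; have := row_edge_ok j i (asm_mx_tr asmA).
rewrite {1}/row_state /edge_state i0 take0 mxE => /orP[]/eqP; [by left | by right].
Qed.

(** The top row has entries 0 and 1 only, as the column states above it are 0; so partial sum 0
    means that the 1 is not yet passed. *)
Lemma top_left_zero (i j : 'I_n) : val i = 0%N ->
  [exists j1 : 'I_n, [&& A i j1 == 1, (j < j1)%N & A i j == 0]]
  = ~~ row_state A i j && (A i j == 0).
Proof.
move=> i0; apply/existsP/andP => [[j1 /and3P[/eqP A1 jj1 A0]]|[st0 A0]].
  split=> //; have := row_edge_ok i j1 asmA; rewrite A1 /edge_ok /=.
  case: (boolP (row_state A i j1)) => // /negbTE s1 _; apply/negP => s0.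
  have := row_state_sum i j1 asmA; rewrite s1 (bigID (fun k : 'I_n => (k < j)%N)) /=.
  have -> : \sum_(k < n | (k < j1)%N && (k < j)%N) A i k = 1.
    rewrite -[RHS]/(true%:R) -s0 row_state_sum //; apply: eq_bigl => k.
    by case: (ltnP k j) => kj; rewrite ?andbF ?andbT // (ltn_trans kj).
  have : 0 <= \sum_(k < n | (k < j1)%N && ~~ (k < j)%N) A i k.
    by apply: sumr_ge0 => k _; case: (top_entry k i0) => ->.
  move: (\sum_(k < n | _) _) => S S0 /eqP; rewrite mulr0n eq_sym gt_eqF //. lia.
have := asm_row_sum i; rewrite (bigID (fun k : 'I_n => (k < j)%N)) /= -row_state_sum //.
rewrite (negbTE st0) add0r => sum1; apply/existsP; apply: contra_eqT sum1.
rewrite negb_exists => /forallP no1; rewrite big1 // => k; rewrite -leqNgt leq_eqVlt.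
case/predU1P=> [/val_inj <-|jk]; first exact/eqP.
by have := no1 k; rewrite jk A0 andbT; case: (top_entry k i0) => ->.
Qed.

(** The column state, which is 0 above the first row, is included so that the count is one of [wa2]
    vertices, those that carry z. *)
Lemma rhoTE : rhoT A = (\sum_(i < n) \sum_(j < n)
  ((val i == 0%N) && [&& ~~ row_state A^T j i, ~~ row_state A i j & A i j == 0%R]))%N.
Proof.
rewrite /rhoT -sum1dep_card [LHS]big_mkcond [RHS]exchange_big; apply: eq_bigr => j _ /=.
have n0 : (0 < n)%N := leq_ltn_trans (leq0n j) (ltn_ord j).
pose i0 := Ordinal n0.
rewrite (bigD1 i0) //= big1 ?addn0 => [|i]; last first.
  by rewrite -val_eqE => /negbTE /= ->.
rewrite /row_state {1}/edge_state take0 /= -/(row_state A i0 j) -top_left_zero //.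
rewrite (_ : [exists i, _]
    = [exists j1 : 'I_n, [&& A i0 j1 == 1, (j < j1)%N & A i0 j == 0]]); first by case: existsP.
apply/existsP/existsP => [[i /existsP[j1 /andP[/eqP iv ?]]]|[j1 ?]].
  by exists j1; rewrite (_ : i0 = i) //; apply: val_inj.
by exists i0; apply/existsP; exists j1.
Qed.

Lemma muE : mu A = (\sum_(i < n) \sum_(j < n) (A i j == -1)%R)%N.
Proof. by rewrite /mu -sum1dep_card pair_bigA big_mkcond; apply: eq_bigr => p _; case: eqP. Qed.

End Statistics.

Section ASMGF.
Variables (R : comNzRingType) (x y : R).

Lemma asm_weights_vertex u v (h r : bool) a : edge_ok h a -> edge_ok r a ->
  vertex_wt (asm_weights x y) u v h r a
  = x ^+ (h && r && (a == 0)) * y ^+ (a == -1) * u ^+ [&& ~~ h, ~~ r & a == 0]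
    * v ^+ [&& ~~ h, ~~ r & a == 0].
Proof.
move=> ha ra; rewrite /vertex_wt ha ra /=; move: ha ra; rewrite /edge_ok.
have [->|_] := eqVneq a 0; first by case: h r => -[] _ _ /=; ring.
by case: h r => -[] // /eqP-> //= _; ring.
Qed.

Lemma prod_expr2 n (c : R) (F : 'I_n -> 'I_n -> nat) :
  \prod_(i < n) \prod_(j < n) c ^+ F i j = c ^+ (\sum_(i < n) \sum_(j < n) F i j)%N.
Proof. by rewrite -prodrXr; apply: eq_bigr => i _; rewrite prodrXr. Qed.

Lemma asm_gf_sum n z w : asm_gf x y n z w = \sum_(A in ASM n)
  x ^+ crossings (int_mx A) * y ^+ mu (int_mx A)
    * z ^+ rhoT (int_mx A) * w ^+ rhoT (int_mx A)^T.
Proof.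
pose ones (c : R) := if n is m.+1 then c :: nseq m 1 else [::].
have onesn c : size (ones c) = n by rewrite /ones; case: (n) => //= m; rewrite size_nseq.
have nth_ones c (i : 'I_n) e : (nth 1 (ones c) i) ^+ e = c ^+ ((val i == 0%N) * e).
  rewrite /ones; case: (n) i => [[]//|m [[|i] lt_i]] /=; rewrite ?mul1n //.
  by rewrite mul0n nth_nseq ltnS in lt_i *; rewrite lt_i expr1n.
transitivity (pfun (asm_weights x y) (ones z) (ones w) (nseq n false)).
  by rewrite /asm_gf /ones; case: (n).
rewrite (pf_asm _ 1 1) //; apply: eq_bigr => A; rewrite inE => /is_asmP asmA.
set M := int_mx A in asmA *.
rewrite muE (rhoTE asmA) (rhoTE (asm_mx_tr asmA)) /crossings -!prod_expr2.
rewrite [X in _ * X]exchange_big -!big_split; apply: eq_bigr => i _ /=.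
rewrite -!big_split; apply: eq_bigr => j _ /=.
rewrite asm_weights_vertex ?row_edge_ok // ?nth_ones.
  have -> : M^T j i = M i j by rewrite mxE.
  by rewrite trmxK !mulnb [X in w ^+ (_ && X)]andbCA [row_state M^T j i && _]andbC.
by have := row_edge_ok j i (asm_mx_tr asmA); rewrite mxE.
Qed.

(** Transposition preserves [crossings] and [mu] and swaps the two refinements, so one family
    [gf_coef] serves for the first row and the first column. *)
Lemma asm_gf_sym n z w : asm_gf x y n z w = asm_gf x y n w z.
Proof.
rewrite !asm_gf_sum (reindex (fun A : 'M[asm_entry]_n => A^T)) /=; last first.
  by exists (fun A => A^T) => A _; rewrite trmxK.
have trE (A : 'M[asm_entry]_n) : int_mx A^T = (int_mx A)^T by rewrite /int_mx map_trmx.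
have asmE (A : 'M[asm_entry]_n) : (A^T \in ASM n) = (A \in ASM n).
  rewrite !inE trE; apply/is_asmP/is_asmP => /asm_mx_tr; rewrite ?trmxK //.
apply: eq_big => [A|A]; first exact: asmE.
rewrite asmE inE => /is_asmP asmA; rewrite trE trmxK crossings_tr -!mulrA.
congr (_ * (_ * _)); last by rewrite mulrC.
rewrite !muE exchange_big; congr (_ ^+ _).
by apply: eq_bigr => i _; apply: eq_bigr => j _; rewrite mxE.
Qed.

End ASMGF.

(** * The relation over Q(x, y) *)

Section RMorphASM.
Variables (R R' : comPzRingType) (phi : {rmorphism R -> R'}) (x y : R).

Lemma rmorph_asm_weights (us vs : seq R) hs :
  phi (pfun (asm_weights x y) us vs hs)
  = pfun (asm_weights (phi x) (phi y)) (map phi us) (map phi vs) hs.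
Proof. by apply: rmorph_pf => u v /=; rewrite ?(rmorphM, rmorph1). Qed.

Lemma rmorph_asm_gf n z w : phi (asm_gf x y n z w) = asm_gf (phi x) (phi y) n (phi z) (phi w).
Proof.
case: n => [|n]; first exact: rmorph1.
by rewrite [LHS]rmorph_asm_weights /= !map_nseq rmorph1.
Qed.

Lemma rmorph_asm_core n z w :
  phi (asm_core x y n z w) = asm_core (phi x) (phi y) n (phi z) (phi w).
Proof.
rewrite /asm_core (rmorph_row_op (fU := phi) (fV := phi) (w' := asm_weights (phi x) (phi y)));
  try by move=> u v /=; rewrite ?(rmorphM, rmorph1).
rewrite map_nseq rmorph1; apply: eq_row_op => t /=.
by rewrite rmorph_asm_weights /= !map_nseq rmorph1.
Qed.

End RMorphASM.

Section Vanishing.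
Variable K : fieldType.
Hypothesis K_char0 : injective (fun n : nat => n%:R : K).

Lemma poly_vanish (p q : {poly K}) : q != 0 -> (forall c, q.[c] != 0 -> p.[c] = 0) -> p = 0.
Proof.
move=> q0 pq0; apply: (mulIf q0); rewrite mul0r.
apply: (@roots_geq_poly_eq0 _ _ [seq n%:R | n <- iota 0 (size (p * q)%R)]).
- apply/allP => _ /mapP[n _ ->]; rewrite /root hornerM mulf_eq0.
  by have [|/pq0 ->] := eqVneq q.[n%:R] 0; rewrite ?eqxx ?orbT.
- by rewrite map_inj_uniq ?iota_uniq.
- by rewrite size_map size_iota.
Qed.

(** The values excluded for the outer variable may depend on the value [c] of the inner one, as the
    conditions of [asm_core_relation] on w depend on z. *)
Lemma poly2_vanish (P : {poly {poly K}}) (q : {poly K}) (r : K -> {poly K}) : q != 0 ->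
    (forall c, q.[c] != 0 -> r c != 0) ->
    (forall c d, q.[c] != 0 -> (r c).[d] != 0 -> (map_poly (horner_eval c) P).[d] = 0) ->
  P = 0.
Proof.
move=> q0 r0 P0; apply/polyP => l; rewrite coef0; apply: (poly_vanish q0) => c qc.
have /polyP/(_ l) : map_poly (horner_eval c) P = 0.
  by apply: (poly_vanish (r0 c qc)) => d; exact: P0.
by rewrite coef_map coef0.
Qed.

End Vanishing.

(** As a single element, the relation can be transported along ring morphisms. *)
Definition core_defect (R : comPzRingType) (x y : R) p z w : R :=
  (1 - z) * (1 - w) * asm_core x y p.+1 z w * asm_gf x y p 1 1
  - (y * asm_gf x y p.+1 1 1 * asm_gf x y p.+1 z w
     + (x * (1 - z) * (1 - w) - y) * asm_gf x y p.+1 z 1 * asm_gf x y p.+1 1 w).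

Lemma rmorph_core_defect (R R' : comPzRingType) (phi : {rmorphism R -> R'}) x y p z w :
  phi (core_defect x y p z w) = core_defect (phi x) (phi y) p (phi z) (phi w).
Proof.
have := rmorph_asm_gf phi x y p 1 1; have := rmorph_asm_gf phi x y p.+1 1 1.
have := rmorph_asm_gf phi x y p.+1 z 1; have := rmorph_asm_gf phi x y p.+1 1 w.
rewrite !rmorph1 /core_defect => <- <- <- <-.
rewrite -(rmorph_asm_gf phi x y p.+1 z w) -(rmorph_asm_core phi x y p.+1 z w).
move: (asm_gf x y p.+1 z w) (asm_gf x y p.+1 z 1) (asm_gf x y p.+1 1 w).
move: (asm_gf x y p.+1 1 1) (asm_gf x y p 1 1) (asm_core x y p.+1 z w) => g1 g2 g3 g4 g5 g6.
by rewrite !(rmorphB, rmorphD, rmorphM, rmorph1).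
Qed.

Lemma core_relation_split (K : fieldType) (s t : K) p : injective (fun n : nat => n%:R : K) ->
    s != 0 -> t != 0 -> s != t -> 1 + s != 0 -> 1 + t != 0 ->
    asm_gf ((1 + s) * (1 + t)) (s * t) p 1 1 != 0 ->
  core_defect ((1 + s) * (1 + t))%:P%:P (s * t)%:P%:P p 'X%:P ('X : {poly {poly K}}) = 0.
Proof.
move=> K0 s0 t0 st s1 t1 gf0.
have lin0 (a b : K) : a != 0 -> a%:P - 'X * b%:P != 0 :> {poly K}.
  move=> a0; apply/negP => /eqP/(congr1 (horner^~ 0)); rewrite hornerD hornerN hornerM hornerX.
  by rewrite mul0r subr0 hornerC horner0 => /eqP; rewrite (negbTE a0).
have linE (a b c : K) : (a%:P - 'X * b%:P).[c] = a - c * b.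
  by rewrite hornerD hornerN hornerM hornerX !hornerC.
apply: (poly2_vanish K0 (q := (1%:P - 'X * (1 + t)%:P) * (1%:P - 'X * (1 + s)%:P))
  (r := fun z => (1%:P - 'X * (1 + s)%:P) *
    ((t * (1 - z * (1 + s)) - s * (1 - z * (1 + t)))%:P
     - 'X * (t * (1 - z * (1 + s)) * (1 + s) - s * (1 - z * (1 + t)) * (1 + t))%:P))).
- by rewrite mulf_neq0 // lin0 ?oner_neq0.
- move=> c; rewrite hornerM !linE mulf_eq0 => /norP[c1 c2].
  rewrite mulf_neq0 //; first by rewrite lin0 ?oner_neq0.
  (* If both coefficients of this linear factor vanished, then [a = b] and [(s - t) * a = 0],
     although [s != t] and [a != 0]. *)
  apply/negP => /eqP E; pose a := t * (1 - c * (1 + s)); pose b := s * (1 - c * (1 + t)).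
  have := linE (a - b) (a * (1 + s) - b * (1 + t)) 0; rewrite E horner0 mul0r subr0 => ab.
  have := linE (a - b) (a * (1 + s) - b * (1 + t)) 1; rewrite E horner0 -ab mul1r sub0r.
  have a0 : a != 0 by rewrite mulf_neq0.
  have -> : b = a by apply/esym/eqP; rewrite -subr_eq0 -ab.
  move/esym/eqP; rewrite oppr_eq0 -mulrBr mulf_eq0 (negbTE a0) /=.
  by rewrite (_ : 1 + s - (1 + t) = s - t) ?subr_eq0 ?(negbTE st) //; ring.
move=> c d; rewrite !hornerM !linE !mulf_eq0 => /norP[c1 c2] /norP[d1 d2].
pose phi : {rmorphism {poly {poly K}} -> K} := horner_eval d \o map_poly (horner_eval c).
have phiC a : phi a%:P%:P = a by rewrite /phi /= map_polyC /= /horner_eval !hornerC.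
have phiz : phi 'X%:P = c by rewrite /phi /= map_polyC /= /horner_eval hornerC hornerX.
have phiw : phi 'X = d by rewrite /phi /= map_polyX /horner_eval hornerX.
rewrite -[LHS]/(phi _) rmorph_core_defect !phiC phiz phiw.
apply/eqP; rewrite subr_eq0; apply/eqP.
apply: asm_core_relation => //.
rewrite (_ : _ - _ = t * (1 - c * (1 + s)) - s * (1 - c * (1 + t)) -
    d * (t * (1 - c * (1 + s)) * (1 + s) - s * (1 - c * (1 + t)) * (1 + t))) //; ring.
Qed.

(** * Descent from a quadratic extension *)

Section Descent.
Variables (F : fieldType) (x y : F) (p : nat).
Hypotheses (F0 : injective (fun n : nat => n%:R : F)) (x0 : x != 0) (y0 : y != 0).
Hypotheses (disc0 : (1 + y - x) ^+ 2 - y *+ 4 != 0) (gf0 : asm_gf x y p 1 1 != 0).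

(* Its roots are s and t with x = (1 + s)(1 + t) and y = s t. *)
Definition param_poly : {poly F} := 'X^2 + (1 + y - x) *: 'X + y%:P.

(** The other root is [phi y / s], and the nonzero discriminant keeps the roots apart. The relation
    holds over [K], and the field morphism [phi] is injective on its coefficients. *)
Lemma core_relation_ext (K : fieldType) (phi : {rmorphism F -> K}) (s : K) :
  root (map_poly phi param_poly) s ->
  core_defect x%:P%:P y%:P%:P p 'X%:P ('X : {poly {poly F}}) = 0.
Proof.
rewrite /root /param_poly !rmorphD /= map_polyXn map_polyZ /= map_polyX map_polyC /=.
rewrite hornerD hornerD hornerXn hornerZ hornerX hornerC => /eqP rt.
have s0 : s != 0.
  apply/eqP => s0; move: rt; rewrite s0 mulr0 expr0n /= !add0r => /eqP.
  by rewrite fmorph_eq0 (negbTE y0).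
pose t := phi y / s.
have stE : s * t = phi y by rewrite /t mulrC divfK.
have stD : s + t = - (1 + phi y - phi x).
  apply: (mulIf s0); rewrite mulrDl [t * s]mulrC stE mulNr.
  apply/eqP; rewrite eq_sym -subr_eq0; apply/eqP.
  rewrite -[RHS]oppr0 -rt !(rmorphB, rmorphD, rmorph1); ring.
have xE : (1 + s) * (1 + t) = phi x.
  rewrite (_ : (1 + s) * (1 + t) = 1 + (s + t) + s * t); last by ring.
  by rewrite stD stE; ring.
have t0 : t != 0 by rewrite mulf_neq0 ?fmorph_eq0 ?invr_eq0.
have /andP[s1 t1] : (1 + s != 0) && (1 + t != 0).
  by rewrite -negb_or -mulf_eq0 xE fmorph_eq0.
have st : s != t.
  apply: contraNneq disc0 => st; rewrite -(fmorph_eq0 phi).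
  rewrite !(rmorphB, rmorphD, rmorphXn, rmorphMn, rmorph1) -sqrrN -stD -stE st.
  by apply/eqP; ring.
have phi_nat : injective (fun n : nat => n%:R : K).
  by move=> n m /eqP; rewrite -!(rmorph_nat phi) fmorph_eq => /eqP/F0.
have gfK : asm_gf ((1 + s) * (1 + t)) (s * t) p 1 1 != 0.
  by rewrite xE stE -(rmorph1 phi) -rmorph_asm_gf fmorph_eq0.
have := core_relation_split phi_nat s0 t0 st s1 t1 gfK.
pose Phi : {rmorphism {poly {poly F}} -> {poly {poly K}}} := map_poly (map_poly phi).
have PhiC a : Phi a%:P%:P = (phi a)%:P%:P by rewrite /Phi /= map_polyC /= map_polyC.
have Phiz : Phi 'X%:P = 'X%:P by rewrite /Phi /= map_polyC /= map_polyX.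
have Phiw : Phi 'X = 'X by rewrite /Phi /= map_polyX.
rewrite xE stE -!PhiC -Phiz -Phiw -rmorph_core_defect => /polyP Phi0.
apply/polyP => l; have := Phi0 l; rewrite coef_map !coef0 => /eqP.
by rewrite map_poly_eq0 => /eqP.
Qed.

(** Either [param_poly] has a root in [F], or, being quadratic, it is irreducible and acquires a
    root in an extension. *)
Lemma core_relation : core_defect x%:P%:P y%:P%:P p 'X%:P ('X : {poly {poly F}}) = 0.
Proof.
apply/eqP; apply: contraT => bad.
have sz : size param_poly = 3%N.
  rewrite /param_poly -addrA size_polyDl size_polyXn // (leq_ltn_trans (size_polyD _ _)) //.
  rewrite ltnS geq_max (leq_trans (size_scale_leq _ _)) ?size_polyX //.
  by rewrite (leq_trans (size_polyC_leq1 _)).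
have noroot a : ~~ root param_poly a.
  apply: contraNN bad => rt; apply/eqP/(@core_relation_ext F idfun a).
  by rewrite map_poly_id.
have irr : irreducible_poly param_poly by apply: cubic_irreducible; rewrite ?sz.
have [L _ [z rt _]] := irredp_FAdjoin irr.
by move: bad; rewrite (core_relation_ext rt) eqxx.
Qed.

End Descent.

Lemma asm_gf_poly (R : fieldType) (a b : R) n :
  asm_gf a%:P b%:P n 'X 1 = \sum_(A in ASM n)
    (a ^ nu (int_mx A) * b ^+ mu (int_mx A)) *: 'X^(rhoT (int_mx A)).
Proof.
rewrite asm_gf_sum; apply: eq_bigr => A; rewrite inE => /is_asmP asmA.
by rewrite nu_crossings // expr1n mulr1 -mul_polyC polyCM !rmorphXn.
Qed.

Lemma horner_asm_gf (R : fieldType) (a b : R) n :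
  (asm_gf a%:P b%:P n 'X 1).[1] = asm_gf a b n 1 1.
Proof.
rewrite -/(horner_eval 1 _) rmorph_asm_gf rmorph1.
by rewrite /= /horner_eval !hornerC hornerX.
Qed.

Lemma ZpolyE n : Zpoly n = asm_gf x%:P y%:P n 'X 1.
Proof. by rewrite asm_gf_poly. Qed.

Lemma ZE n : Z n = asm_gf x y n 1 1.
Proof. by rewrite /Z ZpolyE; exact: horner_asm_gf. Qed.

(** At z = 0 only the matrices with top left entry 1 remain, and [asm_gfS] counts them by the ASMs
    of the previous size. Specialization at x = y = 1 then yields [Z_neq0]. *)
Lemma asm_gf11_ge1 n : 1 <= asm_gf 1 1 n 1 1 :> rat.
Proof.
elim: n => [//|n IH]; apply: (le_trans IH).
have := asm_gfS (1 : rat) 1 n 0 1; rewrite !mul0r add0r => <-.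
rewrite !asm_gf_sum; apply: ler_sum => A _; rewrite !expr1n !mul1r !mulr1.
by rewrite expr0n; case: eqP.
Qed.

Definition eval2 (a b : rat) : {rmorphism {poly {poly rat}} -> rat} :=
  horner_eval b \o map_poly (horner_eval a).

Lemma eval2X a b : eval2 a b 'X%:P = a.
Proof. by rewrite /= map_polyC /= /horner_eval hornerC hornerX. Qed.

Lemma eval2Y a b : eval2 a b 'X = b.
Proof. by rewrite /= map_polyX /horner_eval hornerX. Qed.

Lemma ratfun_neq0 (p : {poly {poly rat}}) a b : eval2 a b p != 0 -> tofrac p != 0.
Proof. by rewrite tofrac_eq0; apply: contraNneq => ->; rewrite rmorph0. Qed.

Lemma Z_neq0 n : Z n != 0.
Proof.
rewrite ZE -(rmorph1 (@tofrac {poly {poly rat}})) -rmorph_asm_gf (@ratfun_neq0 _ 1 1) //.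
rewrite rmorph_asm_gf eval2X eval2Y rmorph1.
by apply: lt0r_neq0; exact: lt_le_trans (asm_gf11_ge1 n).
Qed.

Lemma x_neq0 : x != 0.
Proof. by rewrite (@ratfun_neq0 _ 1 1) // eval2X. Qed.

Lemma y_neq0 : y != 0.
Proof. by rewrite (@ratfun_neq0 _ 1 1) // eval2Y. Qed.

Lemma ratfun_char0 : injective (fun n : nat => n%:R : ratfun).
Proof.
move=> n m /eqP; rewrite -!(rmorph_nat (@tofrac {poly {poly rat}})) tofrac_eq => /eqP.
by move/(congr1 (eval2 0 0)); rewrite !rmorph_nat => /eqP; rewrite eqr_nat => /eqP.
Qed.

Lemma disc_neq0 : (1 + y - x) ^+ 2 - y *+ 4 != 0.
Proof.
rewrite /x /y -(rmorph1 (@tofrac {poly {poly rat}})) -!(rmorphD, rmorphB, rmorphXn, rmorphMn).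
(* At x = 2, y = 1 the discriminant is -4. *)
rewrite (@ratfun_neq0 _ 2 1) //.
have -> : eval2 2 1 ((1 + 'X - 'X%:P) ^+ 2 - 'X *+ 4)
    = (1 + eval2 2 1 'X - eval2 2 1 'X%:P) ^+ 2 - eval2 2 1 'X *+ 4.
  by rewrite rmorphB rmorphXn rmorphB rmorphD rmorph1 rmorphMn.
by rewrite eval2X eval2Y.
Qed.

Lemma ratfun_core_relation p :
  core_defect x%:P%:P y%:P%:P p 'X%:P ('X : {poly {poly ratfun}}) = 0.
Proof.
apply: core_relation ratfun_char0 x_neq0 y_neq0 disc_neq0 _.
by rewrite -ZE Z_neq0.
Qed.

(** * Coefficients *)

Lemma sum_trunc (V : nmodType) m n (f : nat -> V) : (m <= n)%N ->
  (forall j, (m <= j < n)%N -> f j = 0) ->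
  \sum_(0 <= j < n) f j = \sum_(0 <= j < m) f j.
Proof.
move=> mn f0; rewrite (big_cat_nat (leq0n m) mn) /=.
rewrite [X in _ + X]big_nat_cond [X in _ + X]big1 ?addr0 //.
by move=> j; rewrite andbT => /f0.
Qed.

Section PartialSums.
Variable R : comNzRingType.
Implicit Types (f g : nat -> R) (h : nat -> nat -> R).

(* On sequences of coefficients, [psum] is the multiplication by 'X / (1 - 'X) and
   [shift] is the multiplication by 'X. *)
Definition psum f k : R := \sum_(0 <= j < k) f j.
Definition psum2 h k l : R := \sum_(0 <= i < k) \sum_(0 <= j < l) h i j.
Definition shift f k : R := if k is k'.+1 then f k' else 0.
Definition delta0 (k : nat) : R := (k == 0%N)%:R.

Lemma eq_psum f g k : f =1 g -> psum f k = psum g k.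
Proof. by move=> E; apply: eq_bigr => j _; rewrite E. Qed.

Lemma psumS f k : psum f k.+1 = psum f k + f k.
Proof. by rewrite /psum big_nat_recr. Qed.

(** The binomial is the coefficient of X^(k - j) in (X / (1 - X))^(i + 1); the induction is Pascal's
    rule. *)
Lemma iter_psum i f k :
  iter i.+1 psum f k = \sum_(0 <= j < k) 'C(k - j - 1, i)%:R * f j.
Proof.
elim: i k => [|i IH] k; first by apply: eq_bigr => j _; rewrite bin0 mul1r.
elim: k => [|k IHk]; first by rewrite big_geq //= /psum big_geq.
rewrite iterS psumS -iterS IHk IH big_nat_recr //= subSnn subnn mul0r addr0.
rewrite -big_split; apply: eq_big_nat => j /andP[_ jk] /=.
have -> : (k.+1 - j - 1 = (k - j - 1).+1)%N by lia.
by rewrite -mulrDl -natrD -binS.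
Qed.

Lemma iter_psum_shift i f k :
  iter i.+1 psum (shift f) k = \sum_(0 <= j < k.-1) 'C(k - j - 2, i)%:R * f j.
Proof.
rewrite iter_psum; case: k => [|k]; first by rewrite !big_geq.
rewrite big_nat_recl //= mulr0 add0r; apply: eq_big_nat => j _.
by congr ('C(_, _)%:R * _); lia.
Qed.

Lemma iter_psum_delta0 i k : iter i.+1 psum delta0 k = (0 < k)%:R * 'C(k - 1, i)%:R.
Proof.
rewrite iter_psum; case: k => [|k]; first by rewrite big_geq // mul0r.
rewrite big_nat_recl // big1 => [|j _]; last by rewrite mulr0.
by rewrite addr0 mulr1 mul1r subn0.
Qed.

Lemma iter_psum_trunc i f k :
  iter i.+1 psum f k = psum (fun j => 'C(k - j - 1, i)%:R * f j) (k - i).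
Proof.
rewrite iter_psum; apply: sum_trunc => [|j /andP[ij jk]]; first exact: leq_subr.
by rewrite bin_small ?mul0r //; lia.
Qed.

Lemma iter_psum_shift_trunc i f k :
  iter i.+1 psum (shift f) k = psum (fun j => 'C(k - j - 2, i)%:R * f j) (k - i - 1).
Proof.
rewrite iter_psum_shift; apply: sum_trunc => [|j /andP[ij jk]]; first by lia.
by rewrite bin_small ?mul0r //; lia.
Qed.

(** For [i = 0] nothing is summed and only [j = k - 1] contributes, which is what the convention for
    the lower index -1 expresses. *)
Lemma iter_psum_shift_binz i f k : iter i psum (shift f) k
  = psum (fun j => (binz (k%:Z - j%:Z - 2) (i%:Z - 1))%:R * f j) (k - i).
Proof.
case: i => [|i].
  rewrite subn0; case: k => [|k]; first by rewrite /psum big_geq.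
  rewrite psumS /psum big1_seq => [|j]; last first.
    rewrite mem_index_iota => /andP[_ /andP[_ jk]].
    have -> : k.+1%:Z - j%:Z - 2 = (k - j - 1)%N%:Z by lia.
    by rewrite mul0r.
  have -> : k.+1%:Z - k%:Z - 2 = -1 by lia.
  by rewrite mul1r add0r.
rewrite iter_psum_shift_trunc -subnDA addn1; apply: eq_big_nat => j /andP[_ jk].
have -> : k%:Z - j%:Z - 2 = (k - j - 2)%N%:Z by lia.
by have -> : i.+1%:Z - 1 = i%:Z by lia.
Qed.

Lemma psum_sum I (r : seq I) (c u : I -> R) (g : I -> nat -> R) k :
  psum (fun j => \sum_(a <- r) c a * (u a * g a j)) k = \sum_(a <- r) c a * (u a * psum (g a) k).
Proof.
rewrite /psum exchange_big; apply: eq_bigr => a _ /=.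
by rewrite 2!mulr_sumr.
Qed.

Lemma psumD f g k : psum (fun j => f j + g j) k = psum f k + psum g k.
Proof. exact: big_split. Qed.

Lemma psum2Z c h k l : psum2 (fun i j => c * h i j) k l = c * psum2 h k l.
Proof. by rewrite /psum2 mulr_sumr; apply: eq_bigr => i _; rewrite mulr_sumr. Qed.

Lemma eq_psum2 h h' k l : h =2 h' -> psum2 h k l = psum2 h' k l.
Proof. by move=> E; apply: eq_bigr => i _; apply: eq_bigr => j _; rewrite E. Qed.

Lemma psum2D h h' k l : psum2 (fun i j => h i j + h' i j) k l = psum2 h k l + psum2 h' k l.
Proof. by rewrite /psum2 -big_split; apply: eq_bigr => i _; rewrite big_split. Qed.

Lemma psum2M f g k l : psum2 (fun i j => f i * g j) k l = psum f k * psum g l.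
Proof. by rewrite /psum2 /psum mulr_suml; apply: eq_bigr => i _; rewrite mulr_sumr. Qed.

Lemma psum2_sum I (r : seq I) (c : I -> R) (f g : I -> nat -> R) k l :
  psum2 (fun i j => \sum_(a <- r) c a * (f a i * g a j)) k l
  = \sum_(a <- r) c a * (psum (f a) k * psum (g a) l).
Proof.
rewrite /psum2 /psum; under eq_bigr do rewrite exchange_big.
rewrite exchange_big; apply: eq_bigr => a _ /=.
rewrite mulr_suml mulr_sumr; apply: eq_bigr => i _.
by rewrite mulrCA 2!mulr_sumr; apply: eq_bigr => j _; rewrite mulrCA.
Qed.

Lemma coef_div1X (p q : {poly R}) k : (1 - 'X) * p = q -> ('X * p)`_k = psum (fun j => q`_j) k.
Proof.
move=> <-; rewrite /psum; elim: k => [|k IH]; first by rewrite big_geq // coefXM.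
by rewrite big_nat_recr //= -IH mulrBl mul1r coefB addrC subrK coefXM.
Qed.

End PartialSums.

Lemma coef_div1X2 (R : comNzRingType) (P W : {poly {poly R}}) k l :
  (1 - 'X%:P) * (1 - 'X) * P = W ->
  ('X%:P * 'X * P)`_l`_k = psum2 (fun i j => W`_j`_i) k l.
Proof.
move=> PW; rewrite mulrAC -mulrA [_ * 'X]mulrC.
have PW1 : (1 - 'X) * ((1 - 'X%:P) * P) = W by rewrite -PW; ring.
have := coef_div1X l PW1; rewrite mulrCA -polyC1 -polyCB !coefCM => PWl.
rewrite (coef_div1X k PWl) /psum /psum2; apply: eq_bigr => i _.
by rewrite coef_sum.
Qed.

Lemma rhoT_lt n (A : 'M[int]_n.+1) : (rhoT A < n.+1)%N.
Proof.
rewrite ltnS -[X in (_ <= X)%N]/(n.+1.-1) -[X in X.-1]card_ord -(cardsC1 ord_max).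
apply: subset_leq_card; apply/subsetP => j; rewrite !inE.
case/existsP=> i /existsP[j1 /and4P[_ _ jj1 _]].
by apply: contraTneq jj1 => ->; rewrite -leqNgt -ltnS ltn_ord.
Qed.

Lemma size_asm_gf (R : comNzRingType) (a b c : R) n :
  (size (asm_gf a%:P b%:P n.+1 c%:P 'X) <= n.+1)%N.
Proof.
rewrite asm_gf_sum; apply: (leq_trans (size_sum _ _ _)); apply/bigmax_leqP => A _.
rewrite -!rmorphXn -!rmorphM /= mul_polyC (leq_trans (size_scale_leq _ _)) //.
by rewrite size_polyXn rhoT_lt.
Qed.

(** * Iteration of the relation *)

Section Recurrence.
Variables (F : fieldType) (x y : F).
Notation Z n := (asm_gf x y n 1 1).
(* The outer polynomial variable is w, the inner one is z. *)
Notation G n := (asm_gf x%:P%:P y%:P%:P n 'X%:P ('X : {poly {poly F}})).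
Definition gf_coef n k := (asm_gf x%:P y%:P n 'X 1)`_k.
Local Notation psum := (@psum F).
Local Notation delta0 := (@delta0 F).

Hypothesis Z0 : forall n, Z n != 0.
Hypothesis relation : forall p, core_defect x%:P%:P y%:P%:P p 'X%:P ('X : {poly {poly F}}) = 0.

Lemma gf_coef_psum n k : gf_coef n.+1 k = psum (fun l => (G n.+1)`_l`_k) n.+1.
Proof.
rewrite /gf_coef; have <- : (G n.+1).[1] = asm_gf x%:P y%:P n.+1 'X 1.
  by rewrite -/(horner_eval 1 _) rmorph_asm_gf /= /horner_eval !hornerC hornerX.
rewrite (horner_coef_wide _ (size_asm_gf _ _ _ _)) coef_sum /psum big_mkord.
by apply: eq_bigr => i _; rewrite expr1n mulr1.
Qed.

Definition qZ m : F := (Z m * Z m.-1)^-1.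

Lemma G1 k l : (G 1)`_l`_k = delta0 k * delta0 l.
Proof.
have -> : G 1 = 1 by rewrite /asm_gf /= mulr0 add0r !mul1r.
rewrite coef1 /delta0; case: l => [|l]; first by rewrite mulr1 coef1.
by rewrite coef0 mulr0.
Qed.

Lemma G_product m k l :
  (asm_gf x%:P%:P y%:P%:P m 'X%:P 1
   * asm_gf x%:P%:P y%:P%:P m 1 ('X : {poly {poly F}}))`_l`_k
  = gf_coef m k * gf_coef m l.
Proof.
have -> : asm_gf x%:P%:P y%:P%:P m 'X%:P 1 = (asm_gf x%:P y%:P m 'X 1)%:P :> {poly {poly F}}.
  by rewrite rmorph_asm_gf.
rewrite (asm_gf_sym _ _ _ 1).
have -> : asm_gf x%:P%:P y%:P%:P m 'X 1 = map_poly polyC (asm_gf x%:P y%:P m 'X 1).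
  by rewrite rmorph_asm_gf /= !map_polyC map_polyX rmorph1.
by rewrite coefCM coef_map coefMC.
Qed.

(** The [x] term of the relation carries the factor (1 - z)(1 - w), so moving it next to [asm_core]
    forms [P] and only the [y] terms get divided. Hence the [x] term yields shifts and the [y] terms
    double partial sums. *)
Lemma G_rec p k l : (G p.+2)`_l`_k / Z p.+1
  = delta0 k * delta0 l
    + x * qZ p.+1 * (shift (gf_coef p.+1) k * shift (gf_coef p.+1) l)
    + y * psum2 (fun i j => (G p.+1)`_j`_i / Z p
                  - qZ p.+1 * (gf_coef p.+1 i * gf_coef p.+1 j)) k l.
Proof.
have ZC n : asm_gf x%:P%:P y%:P%:P n 1 1 = (Z n)%:P%:P.
  by rewrite !rmorph_asm_gf /= !polyC1.
have coefC2 c (Q : {poly {poly F}}) i j : (c%:P%:P * Q)`_j`_i = c * Q`_j`_i.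
  by rewrite !coefCM.
pose Ap : {poly {poly F}} :=
  asm_gf x%:P%:P y%:P%:P p.+1 'X%:P 1 * asm_gf x%:P%:P y%:P%:P p.+1 1 'X.
pose P := (Z p)%:P%:P * asm_core x%:P%:P y%:P%:P p.+1 'X%:P 'X - x%:P%:P * Ap.
have PW : (1 - 'X%:P) * (1 - 'X) * P = y%:P%:P * ((Z p.+1)%:P%:P * G p.+1 - Ap).
  apply/eqP; rewrite -subr_eq0 -(relation p) /core_defect !ZC /P /Ap; apply/eqP.
  move: (asm_core _ _ _ _ _) (asm_gf _ _ _ 'X%:P 'X) (asm_gf _ _ _ 'X%:P 1) (asm_gf _ _ _ 1 'X).
  by move=> *; ring.
have := coef_div1X2 k l PW.
have -> : 'X%:P * 'X * P = (Z p)%:P%:P * G p.+2 - (Z p)%:P%:P * ((Z p.+1)%:P%:P * 1)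
    - x%:P%:P * ('X%:P * 'X * Ap).
  by rewrite asm_gfS ZC /P {P PW}; move: Ap (asm_core _ _ _ _ _) => *; ring.
rewrite !coefB !coefC2 [(1 : {poly {poly F}})`_l]coef1.
have -> : ((l == 0%N)%:R : {poly F})`_k = delta0 k * delta0 l.
  by rewrite /delta0; case: l => [|l] /=; rewrite ?coef1 ?coef0 ?mulr1 ?mulr0.
have -> : ('X%:P * 'X * Ap)`_l`_k = shift (gf_coef p.+1) k * shift (gf_coef p.+1) l.
  rewrite -mulrA coefCM coefXM coefXM /shift; case: k => [|k]; first by rewrite mul0r.
  by case: l => [|l] /=; rewrite ?mulr0 ?coef0 // G_product.
rewrite (eq_psum2 (h' := fun i j => y * (Z p * Z p.+1)
   * ((G p.+1)`_j`_i / Z p - qZ p.+1 * (gf_coef p.+1 i * gf_coef p.+1 j)))); last first.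
  move=> i j; rewrite coefC2 !coefB coefC2 G_product /qZ -[p.+1.-1]/p.
  by field; rewrite !Z0.
rewrite psum2Z; move: (psum2 _ _ _) ((G p.+2)`_l`_k) => S g E.
apply: (mulfI (mulf_neq0 (Z0 p) (Z0 p.+1))).
transitivity (Z p * g); first by field; rewrite Z0.
have -> : Z p * g = y * (Z p * Z p.+1) * S + Z p * (Z p.+1 * (delta0 k * delta0 l))
   + x * (shift (gf_coef p.+1) k * shift (gf_coef p.+1) l) by rewrite -E; ring.
by rewrite /qZ -[p.+1.-1]/p; field; rewrite !Z0.
Qed.

(** Each use of [G_rec] multiplies by [y] and sums once more in both variables. The subtracted
    product sits inside the double sum and is therefore summed once more than the shifted one; the
    last of the [n + 1] terms with [delta0] comes from [G 1]. *)
Lemma G_closed n k l : (G n.+1)`_l`_k / Z n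
  = \sum_(0 <= i < n.+1) y ^+ i * (iter i psum delta0 k * iter i psum delta0 l)
    + \sum_(0 <= i < n) x * y ^+ i * qZ (n - i)
      * (iter i psum (shift (gf_coef (n - i))) k * iter i psum (shift (gf_coef (n - i))) l)
    + \sum_(0 <= i < n) - (y ^+ i.+1 * qZ (n - i))
      * (iter i.+1 psum (gf_coef (n - i)) k * iter i.+1 psum (gf_coef (n - i)) l).
Proof.
elim: n k l => [|n IH] k l.
  by rewrite G1 big_nat1 !big_geq // !addr0 mul1r -[Z 0]/1 invr1 mulr1.
rewrite G_rec (@eq_psum2 _ _ (fun k l =>
    \sum_(0 <= i < n.+1) y ^+ i * (iter i psum delta0 k * iter i psum delta0 l)
    + \sum_(0 <= i < n) x * y ^+ i * qZ (n - i)
      * (iter i psum (shift (gf_coef (n - i))) k * iter i psum (shift (gf_coef (n - i))) l)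
    + \sum_(0 <= i < n) - (y ^+ i.+1 * qZ (n - i))
      * (iter i.+1 psum (gf_coef (n - i)) k * iter i.+1 psum (gf_coef (n - i)) l)
    + - qZ n.+1 * (gf_coef n.+1 k * gf_coef n.+1 l))); last first.
  by move=> i j; rewrite IH mulNr.
rewrite !psum2D !psum2_sum psum2Z psum2M.
rewrite [in RHS]big_nat_recl // [X in _ = _ + X + _]big_nat_recl //.
rewrite [X in _ = _ + _ + X]big_nat_recl //.
rewrite subn0 !expr0 expr1 mul1r mulr1.
set S1 := \sum_(0 <= i < n.+1) _; set S2 := \sum_(0 <= i < n) _; set S3 := \sum_(0 <= i < n) _.
have -> : \sum_(0 <= i < n.+1)
    y ^+ i.+1 * (iter i.+1 psum delta0 k * iter i.+1 psum delta0 l) = y * S1.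
  by rewrite mulr_sumr; apply: eq_bigr => i _; rewrite exprS -mulrA.
set S2' := \sum_(0 <= i < n) _; have -> : S2' = y * S2.
  by rewrite mulr_sumr; apply: eq_bigr => i _; rewrite subSS exprS /=; ring.
set S3' := \sum_(0 <= i < n) _; have -> : S3' = y * S3.
  by rewrite mulr_sumr; apply: eq_bigr => i _; rewrite subSS (exprS y i.+1) /=; ring.
rewrite /=; ring.
Qed.

(** Setting w = 1 is one more partial sum in the second variable, so the lower indices of the
    binomials in [n] exceed those in [k] by one. The Kronecker delta is the term [i = 0] of the
    first sum in [G_closed]. *)
Theorem gf_coef_formula (n k : nat) : (2 <= n)%N -> (k <= n - 1)%N ->
  gf_coef n k =
    Z (n - 1) * (k == 0%N)%:R
    + Z (n - 1) * \sum_(0 <= i < k)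
        (y ^+ i.+1 * 'C(k - 1, i)%:R * 'C(n - 1, i.+1)%:R
         + y ^+ i * \sum_(0 <= j1 < k - i) \sum_(0 <= j2 < n - i - 1)
             gf_coef (n - i - 1) j1 * gf_coef (n - i - 1) j2
               / (Z (n - i - 1) * Z (n - i - 2))
             * (x * (binz (k%:Z - j1%:Z - 2) (i%:Z - 1))%:R
                  * 'C(n - j2 - 2, i)%:R
                - y * 'C(k - j1 - 1, i)%:R * 'C(n - j2 - 1, i.+1)%:R)).
Proof.
case: n => // n n1; rewrite subn1 -[n.+1.-1]/n => kn.
have -> : gf_coef n.+1 k = Z n * psum (fun l => (G n.+1)`_l`_k / Z n) n.+1.
  by rewrite gf_coef_psum /psum mulr_sumr; apply: eq_bigr => l _; rewrite mulrC divfK.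
rewrite -mulrDr; congr (_ * _); under eq_psum do rewrite G_closed.
rewrite !psumD !psum_sum big_nat_recl // expr0 mul1r.
rewrite -[iter 0 _ _ k]/(delta0 k).
rewrite -[psum _ _]/(iter 1 psum delta0 n.+1) iter_psum_delta0 bin0 !mulr1.
rewrite -!addrA; congr (_ + _); rewrite -!big_split /=.
have E1 j : psum (iter j psum delta0) k = (0 < k)%:R * 'C(k - 1, j)%:R.
  exact: iter_psum_delta0.
have E2 j : psum (psum (iter j psum delta0)) n.+1 = 'C(n, j.+1)%:R.
  by rewrite -[LHS]/(iter j.+2 psum delta0 n.+1) iter_psum_delta0 mul1r subn1.
have E3 j m : iter j psum (shift (gf_coef m)) k
    = psum (fun j1 => (binz (k%:Z - j1%:Z - 2) (j%:Z - 1))%:R * gf_coef m j1) (k - j).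
  exact: iter_psum_shift_binz.
have E4 j m : psum (iter j psum (shift (gf_coef m))) n.+1
    = psum (fun j2 => 'C(n.+1 - j2 - 2, j)%:R * gf_coef m j2) (n.+1 - j - 1).
  exact: iter_psum_shift_trunc.
have E5 j m : psum (iter j psum (gf_coef m)) k
    = psum (fun j1 => 'C(k - j1 - 1, j)%:R * gf_coef m j1) (k - j).
  exact: iter_psum_trunc.
have E6 j m : psum (psum (iter j psum (gf_coef m))) n.+1
    = psum (fun j2 => 'C(n.+1 - j2 - 1, j.+1)%:R * gf_coef m j2) (n.+1 - j - 1).
  by rewrite -(subnDA j) addn1; exact: (iter_psum_trunc j.+1).
have psum0 f : psum f 0 = 0 by rewrite /psum big_geq.
(* [G_closed] sums over [i < n]; for [i >= k] the ranges are empty or the binomial in [k]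
   vanishes. *)
rewrite (sum_trunc kn) => [|i /andP[ki _]]; last first.
  rewrite E1 E3 E5; have -> : (k - i = 0)%N by lia.
  rewrite !psum0 !(mul0r, mulr0) !addr0; case: k ki {E1 E3 E5 kn} => [|k'] ki.
    by rewrite !(mul0r, mulr0).
  by rewrite bin_small ?(mul0r, mulr0) //; lia.
apply: eq_big_nat => i /andP[_ ik].
have k0 : (0 < k)%N by lia.
rewrite E1 E2 E3 E4 E5 E6 k0 mul1r; congr (_ + _); first by rewrite mulrA.
have -> : (n.+1 - i - 1 = n - i)%N by lia.
have -> : (n.+1 - i - 2 = (n - i).-1)%N by lia.
rewrite -!psum2M -!psum2Z -psum2D.
apply: eq_psum2 => j1 j2; rewrite /qZ exprS; ring.
Qed.

End Recurrence.

Theorem corollary8 (n k : nat) (hn : (2 <= n)%N) (hk : (k <= n - 1)%N) :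
  Zcoef n k =
    Z (n - 1) * (k == 0%N)%:R
    + Z (n - 1) * \sum_(0 <= i < k)
        (y ^+ i.+1 * 'C(k - 1, i)%:R * 'C(n - 1, i.+1)%:R
         + y ^+ i * \sum_(0 <= j1 < k - i) \sum_(0 <= j2 < n - i - 1)
             Zcoef (n - i - 1) j1 * Zcoef (n - i - 1) j2
               / (Z (n - i - 1) * Z (n - i - 2))
             * (x * (binz (k%:Z - j1%:Z - 2) (i%:Z - 1))%:R
                  * 'C(n - j2 - 2, i)%:R
                - y * 'C(k - j1 - 1, i)%:R * 'C(n - j2 - 1, i.+1)%:R)).
Proof.
have Z0 m : asm_gf x y m 1 1 != 0 by rewrite -ZE Z_neq0.
have coefE m j : Zcoef m j = gf_coef x y m j by rewrite /Zcoef ZpolyE.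
rewrite coefE (gf_coef_formula Z0 ratfun_core_relation hn hk) !ZE.
congr (_ + _ * _); apply: eq_bigr => i _; congr (_ + _ * _).
apply: eq_bigr => j1 _; apply: eq_bigr => j2 _.
by rewrite !coefE !ZE.
Qed.
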